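(* Let $G$ be a compact group, let $K$ be a homogeneous $G$-space with invariant probability measure $\mu_K$, and let $S\subset C(K)$ be a finite-dimensional $G$-accessible subspace (real or complex scalars). Let $\pi_S$ denote the orthogonal projection of $L_2(K,\mu_K)$ onto $S$, and let $\mathbf k_S$ be the reproducing kernel of $S$ in $L_2(K,\mu_K)$. Then, for every $x_0\in K$, $$\boldsymbol\lambda(S)=\|\pi_S\colon C(K)\to S\|=\int_K|\mathbf k_S(x_0,y)|\,d\mu_K(y),$$ where $\|\pi_S\colon C(K)\to S\|$ is the operator norm of the restriction of $\pi_S$ to $C(K)$ with respect to the supremum norm.
   Context: The scalar field $\mathbb K$ is $\mathbb R$ or $\mathbb C$, and $C(K)=C(K;\mathbb K)$ carries the supremum norm. Projection constants: if $X$ is a subspace of a Banach space $Y$, $\boldsymbol\lambda(X,Y)=\inf\{\|P\|: P\in\mathcal L(Y),\ P^2=P,\ P(Y)=X\}$; for a finite-dimensional Banach space $X$, $\boldsymbol\lambda(X)=\sup_Y\boldsymbol\lambda(X,Y)$, the supremum over all Banach spaces $Y$ (over the same field) containing $X$ isometrically. Here $S$ carries the supremum norm. Projections are bounded and linear. Homogeneous $G$-space: a compact Hausdorff space $K$ with a continuous transitive left action $G\times K\to K$, $(g,x)\mapsto g\bullet x$, of the compact topological group $G$. $\mu_K$ is the unique $G$-invariant regular Borel probability measure on $K$. For $g\in G$, $(L_gf)(x)=f(g^{-1}\bullet x)$. A subspace $S\subset C(K)$ is $G$-invariant if $L_g(S)\subset S$ for all $g\in G$. A projection $Q\colon C(K)\to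 S$ onto a $G$-invariant $S$ is $G$-equivariant if $QL_g=L_gQ$ for all $g\in G$. A finite-dimensional $G$-invariant subspace $S\subset C(K)$ is $G$-accessible if every $G$-equivariant projection $Q\colon C(K)\to S$ coincides with $\pi_S|_{C(K)}$, the restriction to $C(K)$ of the orthogonal projection $\pi_S\colon L_2(K,\mu_K)\to S$. Reproducing kernel: $\mathbf k_S(x,y)=\sum_j\overline{f_j(x)}f_j(y)$, where $(f_j)$ is any orthonormal basis of $S$ in $L_2(K,\mu_K)$ (independent of the basis). *)

(* Defs.v *)
From HB Require Import structures.
From mathcomp Require Import all_boot all_order all_algebra.
From mathcomp Require Import all_classical all_reals all_analysis.
From mathcomp.real_closed Require Import complex.
From mathcomp Require Import ring.

Set Implicit Arguments.
Unset Strict Implicit.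
Unset Printing Implicit Defensive.

Import Order.TTheory GRing.Theory Num.Theory.
Import numFieldNormedType.Exports.

Local Open Scope classical_set_scope.
Local Open Scope ring_scope.

Variant scalar_kind := RealScalars | ComplexScalars.

Definition scalar_field (R : realType) (k : scalar_kind) : numFieldType :=
  match k with RealScalars => R | ComplexScalars => R[i] end.

Section scalar.
Context {R : realType} {k : scalar_kind}.

Definition sRe : scalar_field R k -> R :=
  match k return scalar_field R k -> R with
  | RealScalars => fun x => x
  | ComplexScalars => fun z => complex.Re z
  end.

Definition sIm : scalar_field R k -> R :=
  match k return scalar_field R k -> R with
  | RealScalars => fun=> 0
  | ComplexScalars => fun z => complex.Im z
  end.

(* [smk a b] is [a + ib]; over the reals the imaginary part is dropped. *)
Definition smk : R -> R -> scalar_field R k :=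
  match k return R -> R -> scalar_field R k with
  | RealScalars => fun a _ => a
  | ComplexScalars => fun a b => Complex a b
  end.

Definition sconj (z : scalar_field R k) : scalar_field R k := smk (sRe z) (- sIm z).

(* Norms in a normed module over [scalar_field R k] are scalars; [rnorm v] is
   the norm as a real number. *)
Definition rnorm {V : normedZmodType (scalar_field R k)} (v : V) : R := sRe `|v|.

End scalar.

Section scalar_theory.
Context {R : realType} {k : scalar_kind}.
Implicit Types z w : scalar_field R k.

Lemma sReD z w : sRe (z + w) = sRe z + sRe w.
Proof. by case: k z w => //= -[? ?] [? ?]. Qed.

Lemma sReM_real r z : sRe (smk r 0 * z) = r * sRe z.
Proof. by case: k z => //= -[a b] /=; rewrite mul0r subr0. Qed.

Lemma smkD (r s : R) : smk (r + s) 0 = smk r 0 + smk s 0 :> scalar_field R k.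
Proof. by case: k => //=; congr Complex; rewrite addr0. Qed.

Lemma smk_sRe z : 0 <= z -> smk (sRe z) 0 = z.
Proof. by case: k z => //= -[a b]; rewrite lecE /= => /andP[/eqP->]. Qed.

Lemma ler_smk (r s : R) : (smk r 0 <= smk s 0 :> scalar_field R k) = (r <= s).
Proof. by case: k => //=; rewrite lecR. Qed.

Lemma smk00 : smk 0 0 = 0 :> scalar_field R k.
Proof. by case: k. Qed.

Lemma ler_sRe z w : z <= w -> sRe z <= sRe w.
Proof. by case: k z w => //= -[a b] [c d]; rewrite lecE => /andP[]. Qed.

Lemma sRe0 : sRe (0 : scalar_field R k) = 0.
Proof. by case: k. Qed.

Lemma sRe_smk (a b : R) : sRe (smk a b : scalar_field R k) = a.
Proof. by case: k. Qed.

Lemma smkM (r s : R) : smk (r * s) 0 = smk r 0 * smk s 0 :> scalar_field R k.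
Proof.
by case: k => //=; apply/eqP; rewrite eq_complex /= !mulr0 !mul0r subr0 addr0 !eqxx.
Qed.

Lemma rnormD (V : normedZmodType (scalar_field R k)) (v w : V) :
  rnorm (v + w) <= rnorm v + rnorm w.
Proof. by rewrite /rnorm -sReD ler_sRe// ler_normD. Qed.

Lemma rnorm_ge0 (V : normedZmodType (scalar_field R k)) (v : V) : 0 <= rnorm v.
Proof. by rewrite -sRe0 ler_sRe. Qed.

Lemma rnormM z w : rnorm (z * w) = rnorm z * rnorm w.
Proof.
rewrite /rnorm normrM -[`|z|]smk_sRe// sReM_real; congr (_ * _).
by rewrite sRe_smk.
Qed.

Lemma rnorm0_eq0 (V : normedZmodType (scalar_field R k)) (v : V) :
  rnorm v = 0 -> v = 0.
Proof.
by move=> v0; apply/normr0_eq0; rewrite -[`|v|]smk_sRe// -/(rnorm v) v0 smk00.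
Qed.

End scalar_theory.

HB.mixin Record Group_Topological_isTopologicalGroup G
    & Group G & Topological G := {
  mulg_continuous : continuous (fun p : G * G => (p.1 * p.2)%g) ;
  invg_continuous : continuous (fun g : G => g^-1%g) }.

#[short(type="topologicalGroupType")]
HB.structure Definition TopologicalGroup :=
  {G of Group G & Topological G & Group_Topological_isTopologicalGroup G}.

HB.mixin Record Topological_isCompactHausdorff K & Topological K := {
  compact_setT : compact [set: K] ;
  hausdorff_setT : hausdorff_space K }.

(* Pointedness (a nonempty carrier) is required by the library for the
   carriers of sigma-algebras. *)
#[short(type="compactHausdorffType")]
HB.structure Definition CompactHausdorff :=
  {K of Pointed K & Topological K & Topological_isCompactHausdorff K}.

Record homogeneous_action (G : topologicalGroupType) (K : topologicalType) :=
  HomogeneousAction {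
    action :> G -> K -> K ;
    action1 : forall x, action 1%g x = x ;
    actionM : forall g h x, action (g * h)%g x = action g (action h x) ;
    action_continuous : continuous (fun p : G * K => action p.1 p.2) ;
    action_transitive : forall x y, exists g, action g x = y }.

Section ctsfun_def.
Variables (R : realType) (k : scalar_kind) (K : topologicalType).

Record ctsfun := CtsFun {
  ctsfun_val :> K -> scalar_field R k ;
  ctsfun_continuous : continuous ctsfun_val }.

Lemma ctsfunP (f g : ctsfun) : (forall x, f x = g x) -> f = g.
Proof.
move: f g => [f cf] [g cg] /= /funext fg.
by move: cf cg; rewrite fg => cf cg; rewrite (Prop_irrelevance cf cg).
Qed.

HB.instance Definition _ := gen_eqMixin ctsfun.
HB.instance Definition _ := gen_choiceMixin ctsfun.

Lemma ctsfun0_subproof : continuous (fun _ : K => 0 : scalar_field R k).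
Proof. by move=> x; exact: cvg_cst. Qed.

Lemma ctsfunD_subproof (f g : ctsfun) : continuous (fun x => f x + g x).
Proof. by move=> x; apply: cvgD; exact: ctsfun_continuous. Qed.

Lemma ctsfunN_subproof (f : ctsfun) : continuous (fun x => - f x).
Proof. by move=> x; apply: cvgN; exact: ctsfun_continuous. Qed.

Lemma ctsfunZ_subproof (a : scalar_field R k) (f : ctsfun) :
  continuous (fun x => a * f x).
Proof. by move=> x; apply: cvgM; [exact: cvg_cst|exact: ctsfun_continuous]. Qed.

Let ctsfun0 := CtsFun (@ctsfun0_subproof).
Let ctsfunD f g := CtsFun (@ctsfunD_subproof f g).
Let ctsfunN f := CtsFun (@ctsfunN_subproof f).
Let ctsfunZ a f := CtsFun (@ctsfunZ_subproof a f).

Let ctsfunA : associative ctsfunD.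
Proof. by move=> f g h; apply/ctsfunP => x /=; rewrite addrA. Qed.
Let ctsfunC : commutative ctsfunD.
Proof. by move=> f g; apply/ctsfunP => x /=; rewrite addrC. Qed.
Let ctsfun0D : left_id ctsfun0 ctsfunD.
Proof. by move=> f; apply/ctsfunP => x /=; rewrite add0r. Qed.
Let ctsfunND : left_inverse ctsfun0 ctsfunN ctsfunD.
Proof. by move=> f; apply/ctsfunP => x /=; rewrite addNr. Qed.

HB.instance Definition _ :=
  GRing.isZmodule.Build ctsfun ctsfunA ctsfunC ctsfun0D ctsfunND.

Let ctsfunZA a b f : ctsfunZ a (ctsfunZ b f) = ctsfunZ (a * b) f.
Proof. by apply/ctsfunP => x /=; rewrite mulrA. Qed.
Let ctsfun1Z : left_id 1 ctsfunZ.
Proof. by move=> f; apply/ctsfunP => x /=; rewrite mul1r. Qed.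
Let ctsfunZDr : right_distributive ctsfunZ +%R.
Proof. by move=> a f g; apply/ctsfunP => x /=; rewrite mulrDr. Qed.
Let ctsfunZDl f : {morph ctsfunZ^~ f : a b / a + b}.
Proof. by move=> a b; apply/ctsfunP => x /=; rewrite mulrDl. Qed.

HB.instance Definition _ :=
  GRing.Zmodule_isLmodule.Build (scalar_field R k) ctsfun ctsfunZA ctsfun1Z ctsfunZDr ctsfunZDl.

End ctsfun_def.

Arguments ctsfun_continuous {R k K} c.

Section ctsfun_norm.
Variables (R : realType) (k : scalar_kind) (K : compactHausdorffType).
Implicit Types f g : ctsfun R k K.

Definition supnorm f : R := sup (range (fun x => rnorm (f x))).

Lemma supnorm_has_sup f : has_sup (range (fun x => rnorm (f x))).
Proof.
split; first by exists (rnorm (f point)), point.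
have /compact_near_coveringP := @compact_setT K.
move=> /(_ R (+oo : set_system R) (fun r x => rnorm (f x) <= r) _) [].
  move=> x _.
  near=> y r.
  rewrite -[f y](subrK (f x)) (le_trans (rnormD _ _))// -lerBrDr.
  apply: (@le_trans _ _ 1).
    have -> : 1 = sRe (1 : scalar_field R k) by case: (k).
    apply: ler_sRe; rewrite distrC ltW//.
    by near: y; move/cvgrPdist_lt: (ctsfun_continuous f x) => /(_ 1 ltr01).
  by rewrite lerBrDr /=; near: r; apply: nbhs_pinfty_ge; rewrite num_real.
move=> r [_ +]; move=> /(_ (r + 1)); rewrite ltrDl ltr01 => /(_ isT) H.
by exists (r + 1) => _ [x _ <-]; exact: H.
Unshelve. all: by end_near. Qed.

Lemma supnorm_upper f x : rnorm (f x) <= supnorm f.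
Proof. by apply: ub_le_sup; [case: (supnorm_has_sup f)|exists x]. Qed.

Lemma supnorm_least f r : (forall x, rnorm (f x) <= r) -> supnorm f <= r.
Proof.
move=> fr; apply: ge_sup; first by case: (supnorm_has_sup f).
by move=> _ [x _ <-].
Qed.

Lemma supnorm_ge0 f : 0 <= supnorm f.
Proof. exact: le_trans (rnorm_ge0 _) (supnorm_upper f point). Qed.

Let norm f : scalar_field R k := smk (supnorm f) 0.

Let ler_norm_add f g : norm (f + g) <= norm f + norm g.
Proof.
rewrite /norm -smkD ler_smk; apply: supnorm_least => x.
by apply: (le_trans (rnormD (f x) (g x))); rewrite lerD// supnorm_upper.
Qed.

Let norm_scale (a : scalar_field R k) f : norm (a *: f) = `|a| * norm f.
Proof.
rewrite /norm -[`|a|]smk_sRe// -smkM -/(rnorm a); congr (smk _ 0).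
have [->|a0] := eqVneq a 0.
  rewrite /rnorm normr0 scale0r sRe0 mul0r.
  apply/eqP; rewrite eq_le supnorm_ge0 andbT; apply: supnorm_least => x /=.
  by rewrite /rnorm normr0 sRe0.
apply/eqP; rewrite eq_le; apply/andP; split.
  by apply: supnorm_least => x; rewrite /= rnormM ler_wpM2l ?rnorm_ge0 ?supnorm_upper.
have ra0 : 0 < rnorm a.
  rewrite lt_neqAle rnorm_ge0 andbT eq_sym; apply/eqP => /rnorm0_eq0 /eqP.
  by rewrite (negPf a0).
rewrite mulrC -ler_pdivlMr//; apply: supnorm_least => x.
by rewrite ler_pdivlMr// mulrC -rnormM; exact: (supnorm_upper (a *: f)).
Qed.

Let norm0_eq0 f : norm f = 0 -> f = 0.
Proof.
rewrite /norm => /(congr1 sRe); rewrite sRe_smk sRe0 => f0.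
apply/ctsfunP => x; apply: rnorm0_eq0; apply/eqP.
by rewrite eq_le rnorm_ge0 -f0 supnorm_upper.
Qed.

HB.instance Definition _ := Lmodule_isNormed.Build (scalar_field R k) (ctsfun R k K)
  ler_norm_add norm_scale norm0_eq0.

Lemma rnorm_ctsfunE f : rnorm f = sup (range (fun x => rnorm (f x))).
Proof. exact: sRe_smk. Qed.

End ctsfun_norm.

Section projection_constants.
Context {R : realType} {k : scalar_kind}.
Local Notation F := (scalar_field R k).

Definition opnorm {V W : normedModType F} (f : V -> W) : \bar R :=
  ereal_sup [set (rnorm (f v))%:E | v in [set v | rnorm v <= 1]].

Definition is_projection {Y : normedModType F} (X : set Y)
    (P : {linear Y -> Y}) : Prop :=
  [/\ continuous P, forall y, P (P y) = P y & range P = X].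

Definition rel_projconst {Y : normedModType F} (X : set Y) : \bar R :=
  ereal_inf [set e | exists2 P : {linear Y -> Y},
    is_projection X P & e = opnorm P].

(* [i] need only be linear and isometric on the subspace [X] of [V]. *)
Definition isometric_embedding {V W : normedModType F} (X : set V)
    (i : V -> W) : Prop :=
  (forall a x y, X x -> X y -> i (a *: x + y) = a *: i x + i y) /\
  (forall x, X x -> `|i x| = `|x|).

(* The absolute projection constant of a finite-dimensional subspace [X] of
   [V], regarded as a Banach space with the norm induced by [V]; it does not
   depend on [V]. *)
Definition projconst {V : normedModType F} (X : set V) : \bar R :=
  ereal_sup [set e | exists (Y : completeNormedModType F) (i : V -> Y),
    isometric_embedding X i /\ e = rel_projconst (i @` X)].

Definition spans {V : lmodType F} n (e : 'I_n -> V) (X : set V) : Prop :=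
  X = [set v | exists c : 'I_n -> F, v = \sum_(j < n) c j *: e j].

Definition finite_dimensional {V : lmodType F} (X : set V) : Prop :=
  exists n (e : 'I_n -> V), spans e X.

End projection_constants.

Notation borel K := (g_sigma_algebraType (@open K)).

Section invariant_measure.
Variables (R : realType) (K : compactHausdorffType).
Variable mu : probability (borel K) R.

Definition regular_measure : Prop :=
  forall A : set (borel K), measurable A ->
    mu A = ereal_inf [set mu U | U in [set U : set K | open U /\ A `<=` U]] /\
    mu A = ereal_sup [set mu C | C in [set C : set K | compact C /\ C `<=` A]].

Definition invariant_measure (G : topologicalGroupType)
    (act : homogeneous_action G K) : Prop :=
  forall (g : G) (A : set (borel K)), measurable A ->
    mu (act g @` A) = mu A.

End invariant_measure.

Section L2.
Variables (R : realType) (k : scalar_kind) (K : compactHausdorffType).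
Variable mu : probability (borel K) R.
Local Notation F := (scalar_field R k).
Implicit Types S : set (ctsfun R k K).

Definition scalar_integral (f : K -> F) : F :=
  smk (\int[mu]_x sRe (f x)) (\int[mu]_x sIm (f x)).

Definition inner_L2 (f g : K -> F) : F := scalar_integral (fun x => f x * sconj (g x)).

(* The orthogonal projection onto [S], applied to (a representative of) an
   element [f] of [L_2(mu)]: the element [h] of [S] such that [f - h] is
   orthogonal to [S]. *)
Definition orth_proj S (f : K -> F) : ctsfun R k K :=
  xget 0 [set h | S h /\ forall s, S s -> inner_L2 (fun x => f x - h x) s = 0].

Definition orthonormal_basis S n (e : 'I_n -> ctsfun R k K) : Prop :=
  (forall i j, inner_L2 (e i) (e j) = (i == j)%:R) /\ spans e S.

Definition basis_kernel n (e : 'I_n -> ctsfun R k K) (x y : K) : F :=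
  \sum_(j < n) sconj (e j x) * e j y.

Definition rep_kernel S : K -> K -> F :=
  xget (fun _ _ => 0) [set kS | exists n (e : 'I_n -> ctsfun R k K),
    orthonormal_basis S e /\ kS = basis_kernel e].

End L2.

Section kernel_independence.
Variables (R : realType) (k : scalar_kind) (K : compactHausdorffType).
Variable mu : probability (borel K) R.
Local Notation F := (scalar_field R k).
Implicit Types (z w : F) (f g : ctsfun R k K).

Let normcE (a b : R) :
  `|Complex a b : scalar_field R ComplexScalars| =
  Complex (Num.sqrt (a ^+ 2 + b ^+ 2)) 0.
Proof. exact: normc_def. Qed.

Let sRe_norm z : `|sRe z| <= rnorm z.
Proof.
rewrite /rnorm; case: (k) z => [z|[a b]]; first by [].
by rewrite normcE -sqrtr_sqr ler_wsqrtr// lerDl sqr_ge0.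
Qed.

Let sIm_norm z : `|sIm z| <= rnorm z.
Proof.
rewrite /rnorm; case: (k) z => [z|[a b]]; first by rewrite normr0 normr_ge0.
by rewrite normcE -sqrtr_sqr ler_wsqrtr// lerDr sqr_ge0.
Qed.

Let norm_sconj z : `|sconj z| = `|z|.
Proof.
by case: (k) z => // -[a b]; rewrite [LHS]normcE [RHS]normcE sqrrN.
Qed.

Let sconjB z w : sconj z - sconj w = sconj (z - w).
Proof.
rewrite /sconj; case: (k) z w => //= -[a b] [c d] /=.
by congr Complex; rewrite opprD.
Qed.

Let sconjD z w : sconj (z + w) = sconj z + sconj w.
Proof.
rewrite /sconj; case: (k) z w => //= -[a b] [c d] /=.
by congr Complex; rewrite opprD.
Qed.

Let sconjM z w : sconj (z * w) = sconj z * sconj w.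
Proof.
by rewrite /sconj; case: (k) z w => //= -[a b] [c d] /=; congr Complex; ring.
Qed.

Let sconjK z : sconj (sconj z) = z.
Proof. by rewrite /sconj; case: (k) z => //= -[a b] /=; rewrite opprK. Qed.

Let sconj_sum n (h : 'I_n -> F) : sconj (\sum_j h j) = \sum_j sconj (h j).
Proof.
apply: (big_morph _ sconjD).
by rewrite /sconj; case: (k) => //=; rewrite oppr0.
Qed.

Let lip_continuous (h : F -> R) :
  (forall z w, `|h z - h w| <= rnorm (z - w)) -> continuous h.
Proof.
move=> hl z; apply/(@cvgrPdist_lt _ _ _ (nbhs z) (nbhs_filter z)) => e e0.
have e0' : 0 < smk e 0 :> F.
  rewrite lt_neqAle -{2}smk00 ler_smk (ltW e0) andbT -smk00; apply/eqP.
  by move=> /(congr1 sRe); rewrite !sRe_smk => e1; rewrite -e1 ltxx in e0.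
near=> w; apply: le_lt_trans (hl _ _) _.
have : `|z - w| < smk e 0 by near: w; exact: cvgr_dist_lt.
rewrite lt_neqAle => /andP[ne /ler_sRe]; rewrite sRe_smk le_eqVlt => /predU1P[h1|//].
by move/eqP: ne; rewrite -[`|_|]smk_sRe// h1.
Unshelve. all: by end_near. Qed.

Let sReB z w : sRe z - sRe w = sRe (z - w).
Proof. by case: (k) z w => //= -[a b] [c d]. Qed.

Let sImB z w : sIm z - sIm w = sIm (z - w).
Proof. by case: (k) z w => /= [z w|[a b] [c d]//]; rewrite subrr. Qed.

Let sRe_continuous : continuous (@sRe R k).
Proof. by apply: lip_continuous => z w; rewrite sReB. Qed.

Let sIm_continuous : continuous (@sIm R k).
Proof. by apply: lip_continuous => z w; rewrite sImB. Qed.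

Let sconj_continuous : continuous (@sconj R k).
Proof.
move=> z; apply/(@cvgrPdist_lt _ _ _ (nbhs z) (nbhs_filter z)) => e e0; near=> w.
rewrite sconjB norm_sconj; near: w; exact: cvgr_dist_lt.
Unshelve. all: by end_near. Qed.

Let cts_integrable (h : F -> R) f : continuous h ->
  (forall z, `|h z| <= rnorm z) -> mu.-integrable setT (EFin \o (h \o f)).
Proof.
move=> ch hl; apply: measurable_bounded_integrable => //=.
- by rewrite probability_setT ltry.
- apply: (measurability _ (measurable_realfun.RGenOpens.measurableE R)).
  move=> _ [_ [a [b ->] <-]]; rewrite setTI; apply: sub_sigma_algebra.
  have /continuousP : continuous (h \o f : K -> R).
    by move=> x; apply: continuous_comp; [exact: ctsfun_continuous|exact: ch].
  by apply; exact: interval_open.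
- exists (supnorm f); split; first exact: num_real.
  move=> r fr x _ /=; apply: le_trans (ltW fr).
  exact: le_trans (hl _) (supnorm_upper f x).
Qed.

Let inner_L2_cfun f g : exists h : ctsfun R k K,
  forall x, h x = f x * sconj (g x).
Proof.
suff c : continuous (fun x => f x * sconj (g x)) by exists (CtsFun c).
move=> x; apply: cvgM; first exact: ctsfun_continuous.
by apply: continuous_comp; [exact: ctsfun_continuous|exact: sconj_continuous].
Qed.

Let sReM z w : sRe (z * w) = sRe z * sRe w - sIm z * sIm w.
Proof. by case: (k) z w => /= [z w|[a b] [c d]//]; rewrite mul0r subr0. Qed.

Let sImM z w : sIm (z * w) = sRe z * sIm w + sIm z * sRe w.
Proof. by case: (k) z w => /= [z w|[a b] [c d]//]; rewrite mul0r mulr0 addr0. Qed.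

Let sImD z w : sIm (z + w) = sIm z + sIm w.
Proof. by case: (k) z w => /= [z w|[a b] [c d]//]; rewrite addr0. Qed.

Let sIm_real z : k = RealScalars -> sIm z = 0.
Proof. by case: (k) z. Qed.

Let smkDD (a b c d : R) : smk (a + c) (b + d) = smk a b + smk c d :> F.
Proof. by case: (k). Qed.

Let smkMM (a b c d : R) (kI : k = RealScalars -> b = 0) :
  smk a b * smk c d = smk (a * c - b * d) (a * d + b * c) :> F.
Proof. by case: (k) kI => //= ->//; rewrite mul0r subr0. Qed.

Local Notation sint := (@scalar_integral R k K mu).
Local Notation inn := (@inner_L2 R k K mu).

Let sintegralD f g :
  sint (fun x => f x + g x) = sint f + sint g.
Proof.
have iRe h := @cts_integrable _ h sRe_continuous sRe_norm.
have iIm h := @cts_integrable _ h sIm_continuous sIm_norm.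
rewrite /scalar_integral -smkDD; congr smk.
  under eq_Rintegral do rewrite sReD.
  by rewrite RintegralD//=; [exact: iRe|exact: iRe].
under eq_Rintegral do rewrite sImD.
by rewrite RintegralD//=; [exact: iIm|exact: iIm].
Qed.

Let sintegralZ a f :
  sint (fun x => a * f x) = a * sint f.
Proof.
have iRe h := @cts_integrable _ h sRe_continuous sRe_norm.
have iIm h := @cts_integrable _ h sIm_continuous sIm_norm.
have iZ (r : R) (h : K -> R) : mu.-integrable setT (EFin \o h) ->
    mu.-integrable setT (EFin \o (fun x => r * h x)).
  by move=> ih; exact: (integrableZl measurableT r ih).
have aE : a = smk (sRe a) (sIm a) by case: (k) a => //= -[].
rewrite [in RHS]aE.
rewrite /scalar_integral smkMM; last exact: sIm_real.
congr smk.
  under eq_Rintegral do rewrite sReM.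
  rewrite RintegralB//=; [|exact/iZ/iRe|exact/iZ/iIm].
  by rewrite !RintegralZl//; first [exact: iRe|exact: iIm].
under eq_Rintegral do rewrite sImM.
rewrite RintegralD//=; [|exact/iZ/iIm|exact/iZ/iRe].
by rewrite !RintegralZl//; first [exact: iRe|exact: iIm].
Qed.

Let innerDl f g (h : ctsfun R k K) : inn (f + g : ctsfun R k K) h = inn f h + inn g h.
Proof.
have [u uE] := inner_L2_cfun f h; have [v vE] := inner_L2_cfun g h.
rewrite /inner_L2 -(funext uE) -(funext vE) -sintegralD; congr scalar_integral.
by apply/funext => x; rewrite uE vE -mulrDl.
Qed.

Let innerZl a f (h : ctsfun R k K) : inn (a *: f : ctsfun R k K) h = a * inn f h.
Proof.
have [u uE] := inner_L2_cfun f h.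
rewrite /inner_L2 -(funext uE) -sintegralZ; congr scalar_integral.
by apply/funext => x; rewrite uE mulrA.
Qed.

Let inner_L2_suml n (c : 'I_n -> F) (e : 'I_n -> ctsfun R k K)
    (h : ctsfun R k K) :
  inn (\sum_j c j *: e j : ctsfun R k K) h = \sum_j c j * inn (e j) h.
Proof.
rewrite (big_morph (fun f : ctsfun R k K => inn f h)
  (fun f g => innerDl f g h) (id1 := 0)).
  by apply: eq_bigr => j _; rewrite innerZl.
by rewrite -[0](scale0r (0 : ctsfun R k K)) innerZl mul0r.
Qed.

Let inner_L2_sym f g : inn g f = sconj (inn f g).
Proof.
have [u uE] := inner_L2_cfun f g.
rewrite /inner_L2 -(funext uE).
have -> : (fun x => g x * sconj (f x)) = (fun x => sconj (u x)).
  by apply/funext => x; rewrite uE sconjM sconjK mulrC.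
rewrite [in RHS]/sconj /scalar_integral.
under eq_Rintegral do rewrite /sconj sRe_smk.
have Ism (a b : R) : sIm (smk a b : F) = sIm (smk 0 1 : F) * b.
  by case: (k) => /=; rewrite ?mul0r ?mul1r.
have im0 z : sIm z = sIm (smk 0 1 : F) * sIm z.
  by case: (k) z => [z|[a b]] /=; rewrite ?mul0r ?mul1r.
rewrite sRe_smk; congr smk.
under eq_Rintegral do rewrite /sconj Ism mulrN -im0 -mulN1r.
rewrite RintegralZl//; last exact: (@cts_integrable _ u sIm_continuous sIm_norm).
rewrite mulN1r Ism; congr (- _).
rewrite -RintegralZl//; last exact: (@cts_integrable _ u sIm_continuous sIm_norm).
by apply: eq_Rintegral => x _; rewrite -im0.
Qed.

Let onb_expansion (S : set (ctsfun R k K)) n (e : 'I_n -> ctsfun R k K) f :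
  orthonormal_basis mu S e -> S f -> f = \sum_j inn f (e j) *: e j.
Proof.
move=> [one Se]; rewrite Se => -[c ->]; apply: eq_bigr => j _; congr (_ *: _).
rewrite inner_L2_suml (bigD1 j)//= one eqxx mulr1 big1 ?addr0// => i ij.
by rewrite one (negbTE ij) mulr0.
Qed.

Let ctsfun_sumE n (h : 'I_n -> ctsfun R k K) x :
  (\sum_j h j : ctsfun R k K) x = \sum_j h j x.
Proof. exact: (big_morph (fun f : ctsfun R k K => f x)). Qed.

(* The choice made in [rep_kernel] is immaterial. *)
Lemma rep_kernelE (S : set (ctsfun R k K)) n (e : 'I_n -> ctsfun R k K) :
  orthonormal_basis mu S e -> rep_kernel mu S = basis_kernel e.
Proof.
move=> onbe; rewrite /rep_kernel; case: xgetP => [_ -> /= [m [e' [onbe' ->]]]|].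
  have Se' j : S (e' j).
    rewrite (onbe'.2); exists (fun i => (i == j)%:R).
    rewrite (bigD1 j)//= eqxx scale1r big1 ?addr0// => i ij.
    by rewrite (negbTE ij) scale0r.
  have Se j : S (e j).
    rewrite (onbe.2); exists (fun i => (i == j)%:R).
    rewrite (bigD1 j)//= eqxx scale1r big1 ?addr0// => i ij.
    by rewrite (negbTE ij) scale0r.
  apply/funext => x; apply/funext => y; rewrite /basis_kernel.
  under eq_bigr => j _.
    rewrite {2}(onb_expansion onbe (Se' j)) ctsfun_sumE big_distrr /=.
    over.
  rewrite exchange_big /=; apply: eq_bigr => i _.
  have -> : e i x = \sum_j inn (e i) (e' j) * e' j x.
    by rewrite {1}(onb_expansion onbe' (Se i)) ctsfun_sumE.
  rewrite sconj_sum big_distrl /=.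
  by apply: eq_bigr => j _; rewrite sconjM -inner_L2_sym mulrA [_ * inner_L2 _ _ _]mulrC.
by move/(_ (basis_kernel e)); case; exists n, e.
Qed.

End kernel_independence.

Section accessible.
Variables (R : realType) (k : scalar_kind).
Variables (G : topologicalGroupType) (K : compactHausdorffType).
Variable act : homogeneous_action G K.

Lemma translate_subproof (g : G) (f : ctsfun R k K) :
  continuous (fun x => f (act g^-1%g x)).
Proof.
move=> x; apply: (continuous_comp (g := f)); last exact: ctsfun_continuous.
apply: (@continuous_comp _ _ _ (fun x : K => (g^-1%g, x))
  (fun p : G * K => act p.1 p.2)); last exact: action_continuous.
by apply: cvg_pair; [exact: cvg_cst|exact: cvg_id].
Qed.

Definition translate (g : G) (f : ctsfun R k K) : ctsfun R k K :=
  CtsFun (@translate_subproof g f).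

Definition invariant_subspace (S : set (ctsfun R k K)) : Prop :=
  forall g f, S f -> S (translate g f).

Definition equivariant (Q : ctsfun R k K -> ctsfun R k K) : Prop :=
  forall g f, Q (translate g f) = translate g (Q f).

Definition accessible (mu : probability (borel K) R)
    (S : set (ctsfun R k K)) : Prop :=
  [/\ finite_dimensional S, invariant_subspace S &
      forall Q : {linear ctsfun R k K -> ctsfun R k K},
        is_projection S Q -> equivariant Q ->
        forall f : ctsfun R k K, Q f = orth_proj mu S f].

End accessible.

(* Main.v *)
(* Write N for the integral of |k_S(x, -)|.  Translation by g maps an orthonormal
   basis of S to another one, so k_S(g x, g y) = k_S(x, y) and N does not depend on
   x; as pi_S f (x) is the integral of f(y) conj(k_S(x, y)), the norm of pi_S is N.

   Upper bound: let i embed S isometrically in Y.  On the S-valued functions u on K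
   the functional sending u to the integral of u(x)(x) is bounded by the integral
   of |u(x)|.  A Hahn-Banach extension of it to Y-valued functions, evaluated at
   conj(e_j) y for an orthonormal basis e_j of S, gives the coefficients of a
   projection of Y onto i(S), and this projection has norm at most N.

   Lower bound: S is a subspace of C(K), which is complete.  Averaging
   L_g^-1 P L_g over G turns a projection P of C(K) onto S into an equivariant one
   of no larger norm, which is pi_S by accessibility.  The average is taken with
   respect to a right-invariant mean on C(G): for continuous h some finite average
   of right translates of h is uniformly close to a constant, and that constant is
   unique because right averages commute with left averages. *)
Require Import Defs.
From HB Require Import structures.
From mathcomp Require Import all_boot all_order all_algebra.
From mathcomp Require Import all_classical all_reals all_analysis.
From mathcomp.real_closed Require Import complex.
From mathcomp Require Import ring lra.

Set Implicit Arguments.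
Unset Strict Implicit.
Unset Printing Implicit Defensive.

Import Order.TTheory GRing.Theory Num.Theory.
Import numFieldNormedType.Exports.

Local Open Scope classical_set_scope.
Local Open Scope ring_scope.

(** * Scalars and bounded operators *)

Lemma continuous_sum (F : numFieldType) (V : normedModType F) (X : topologicalType)
    (I : Type) (s : seq I) (f : I -> X -> V) :
  (forall i, continuous (f i)) -> continuous (fun x => \sum_(i <- s) f i x).
Proof.
move=> cf; elim: s => [|i s IH] x.
  by under eq_fun do rewrite big_nil; exact: cvg_cst.
by under eq_fun do rewrite big_cons; apply: cvgD; [exact: cf|exact: IH].
Qed.

Section scalars.
Context {R : realType} {k : scalar_kind}.
Local Notation F := (scalar_field R k).
Implicit Types z w : F.

Lemma normcE (a b : R) :
  `|Complex a b : scalar_field R ComplexScalars| =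
  Complex (Num.sqrt (a ^+ 2 + b ^+ 2)) 0.
Proof. exact: normc_def. Qed.

Lemma smkE z : smk (sRe z) (sIm z) = z.
Proof. by case: (k) z => // -[]. Qed.

Lemma sReN z : sRe (- z) = - sRe z. Proof. by case: (k) z => // -[]. Qed.
Lemma sImN z : sIm (- z) = - sIm z.
Proof. by case: (k) z => [z|[]//]; rewrite /= oppr0. Qed.
Lemma sImD z w : sIm (z + w) = sIm z + sIm w.
Proof. by case: (k) z w => /= [z w|[a b] [c d]//]; rewrite addr0. Qed.
Lemma sReM z w : sRe (z * w) = sRe z * sRe w - sIm z * sIm w.
Proof. by case: (k) z w => /= [z w|[a b] [c d]//]; rewrite mul0r subr0. Qed.
Lemma sImM z w : sIm (z * w) = sRe z * sIm w + sIm z * sRe w.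
Proof. by case: (k) z w => /= [z w|[a b] [c d]//]; rewrite mul0r mulr0 addr0. Qed.

Lemma sRe_inj z w : sRe z = sRe w -> sIm z = sIm w -> z = w.
Proof. by move=> zw1 zw2; rewrite -[z]smkE -[w]smkE zw1 zw2. Qed.

(* [sIm (smk 0 1)] is 0 over the reals and 1 over the complex numbers. *)
Lemma sIm_smk (a b : R) : sIm (smk a b : F) = sIm (smk 0 1 : F) * b.
Proof. by case: (k) => /=; rewrite ?mul0r ?mul1r. Qed.
Lemma sIm_unit z : sIm (smk 0 1 : F) * sIm z = sIm z.
Proof. by case: (k) z => [z|[a b]] /=; rewrite ?mul0r ?mul1r. Qed.
Lemma sIm_smk0 (a : R) : sIm (smk a 0 : F) = 0.
Proof. by rewrite sIm_smk mulr0. Qed.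

Lemma sRe_norm z : `|sRe z| <= rnorm z.
Proof.
rewrite /rnorm; case: (k) z => [z|[a b]]; first by [].
by rewrite normcE -sqrtr_sqr ler_wsqrtr// lerDl sqr_ge0.
Qed.

Lemma sIm_norm z : `|sIm z| <= rnorm z.
Proof.
rewrite /rnorm; case: (k) z => [z|[a b]]; first by rewrite normr0 normr_ge0.
by rewrite normcE -sqrtr_sqr ler_wsqrtr// lerDr sqr_ge0.
Qed.

Lemma rnorm_smk0 (a : R) : rnorm (smk a 0 : F) = `|a|.
Proof.
rewrite /rnorm; case: (k) => //; rewrite [smk _ _]/= normcE /=.
by rewrite expr0n addr0 sqrtr_sqr.
Qed.

Lemma rnorm_sqr z : rnorm z ^+ 2 = sRe z ^+ 2 + sIm z ^+ 2.
Proof.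
rewrite /rnorm; case: (k) z => [z|[a b]].
  by rewrite /= expr0n addr0 real_normK ?num_real.
by rewrite normcE /= sqr_sqrtr// addr_ge0 ?sqr_ge0.
Qed.

Lemma sRe_conj z : sRe (sconj z) = sRe z. Proof. exact: sRe_smk. Qed.
Lemma sIm_conj z : sIm (sconj z) = - sIm z.
Proof. by rewrite /sconj sIm_smk mulrN sIm_unit. Qed.

Lemma sconjD z w : sconj (z + w) = sconj z + sconj w.
Proof.
by apply: sRe_inj; rewrite ?sRe_conj ?sIm_conj ?sReD ?sImD ?sRe_conj ?sIm_conj ?opprD.
Qed.

Lemma sconjM z w : sconj (z * w) = sconj z * sconj w.
Proof.
by apply: sRe_inj; rewrite ?sRe_conj ?sIm_conj ?sReM ?sImM ?sRe_conj ?sIm_conj; ring.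
Qed.

Lemma sconjK : involutive (@sconj R k).
Proof. by move=> z; apply: sRe_inj; rewrite !(sRe_conj, sIm_conj) ?opprK. Qed.

Lemma sconjN z : sconj (- z) = - sconj z.
Proof. by apply: sRe_inj; rewrite !(sRe_conj, sIm_conj, sReN, sImN). Qed.

Lemma sconj0 : sconj (0 : F) = 0.
Proof. by rewrite /sconj; case: (k) => //=; rewrite oppr0. Qed.

Lemma sconj_sum n (h : 'I_n -> F) : sconj (\sum_j h j) = \sum_j sconj (h j).
Proof. exact: (big_morph _ sconjD sconj0). Qed.

Lemma rnorm_conj z : rnorm (sconj z) = rnorm z.
Proof.
apply/eqP; rewrite -(@eqrXn2 _ 2)// ?rnorm_ge0//.
by rewrite !rnorm_sqr sRe_conj sIm_conj sqrrN.
Qed.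

Lemma mul_sconj z : z * sconj z = smk (rnorm z ^+ 2) 0.
Proof.
by apply: sRe_inj; rewrite ?sReM ?sImM sRe_conj sIm_conj ?sRe_smk ?sIm_smk0 ?rnorm_sqr; ring.
Qed.

Lemma rnorm0 {V : normedZmodType F} : rnorm (0 : V) = 0.
Proof. by rewrite /rnorm normr0 sRe0. Qed.

Lemma rnormN {V : normedZmodType F} (v : V) : rnorm (- v) = rnorm v.
Proof. by rewrite /rnorm normrN. Qed.

Lemma rnormB {V : normedZmodType F} (v w : V) : rnorm (v - w) = rnorm (w - v).
Proof. by rewrite /rnorm distrC. Qed.

Lemma rnormZ {V : normedModType F} (a : F) (v : V) : rnorm (a *: v) = rnorm a * rnorm v.
Proof.
rewrite /rnorm normrZ -[`|a|]smk_sRe// sReM_real; congr (_ * _).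
by rewrite sRe_smk.
Qed.

Lemma rnorm_dist {V : normedZmodType F} (v w : V) :
  `|rnorm v - rnorm w| <= rnorm (v - w).
Proof.
rewrite ler_norml; apply/andP; split.
  by rewrite lerNl opprB lerBlDr rnormB -{1}[w](subrK v) rnormD.
by rewrite lerBlDr -{1}[v](subrK w) rnormD.
Qed.

Lemma rnorm1 : rnorm (1 : F) = 1.
Proof. by rewrite /rnorm normr1; case: (k). Qed.

Lemma rnorm_gt0 {V : normedZmodType F} (v : V) : v != 0 -> 0 < rnorm v.
Proof.
move=> v0; rewrite lt_neqAle rnorm_ge0 andbT eq_sym.
by apply: contra v0 => /eqP/rnorm0_eq0 ->.
Qed.

Lemma ltr_smk (r s : R) : (smk r 0 < smk s 0 :> F) = (r < s).
Proof.
rewrite !lt_neqAle ler_smk; congr (~~ _ && _).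
by apply/eqP/eqP => [/(congr1 sRe)|->//]; rewrite !sRe_smk.
Qed.

Lemma normr_rnorm {V : normedZmodType F} (v : V) : `|v| = smk (rnorm v) 0.
Proof. by rewrite smk_sRe. Qed.

(** In the order on the complex numbers a positive element has zero imaginary part, so every radius
    in [F] comes from a real one. *)
Lemma smk_gt0P (e : F) : 0 < e -> exists2 r : R, 0 < r & e = smk r 0.
Proof.
move=> e0; exists (sRe e); last by rewrite smk_sRe// ltW.
by rewrite -ltr_smk smk_sRe ?ltW// smk00.
Qed.

Section convergence.
Context {V : normedModType F}.

(** By [smk_gt0P] real radii suffice to test convergence; estimates can then be carried out in [R]
    for both kinds of scalars. *)
Lemma cvg_rnormP {T : Type} {FF : set_system T} {FFF : Filter FF} (f : T -> V) (l : V) :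
  f @ FF --> l <-> forall e : R, 0 < e -> \forall x \near FF, rnorm (l - f x) < e.
Proof.
split=> [/cvgrPdist_lt fl e e0|fl].
  have e0' : 0 < smk e 0 :> F by rewrite -smk00 ltr_smk.
  by near do rewrite -ltr_smk -normr_rnorm; exact: fl.
apply/cvgrPdist_lt => _ /smk_gt0P[r r0 ->].
by near do rewrite normr_rnorm ltr_smk; exact: fl.
Unshelve. all: by end_near. Qed.

Lemma lipschitz_continuous (h : V -> R) :
  (forall u v : V, `|h u - h v| <= rnorm (u - v)) -> continuous h.
Proof.
move=> hl z; apply/(@cvgrPdist_lt _ _ _ (nbhs z) (nbhs_filter z)) => e e0.
have /cvg_rnormP/(_ e e0) H : id @ z --> z by [].
by near=> w; apply: le_lt_trans (hl _ _) _; near: w.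
Unshelve. all: by end_near. Qed.

Lemma rnorm_continuous : continuous (@rnorm R k V).
Proof. by apply: lipschitz_continuous; exact: rnorm_dist. Qed.

End convergence.

Lemma sRe_continuous : continuous (@sRe R k).
Proof. by apply: (@lipschitz_continuous F) => z w; rewrite -sReN -sReD sRe_norm. Qed.

Lemma sIm_continuous : continuous (@sIm R k).
Proof. by apply: (@lipschitz_continuous F) => z w; rewrite -sImN -sImD sIm_norm. Qed.

Lemma sconj_continuous : continuous (@sconj R k).
Proof.
move=> z; apply/(@cvg_rnormP F _ (nbhs z) (nbhs_filter z)) => e e0.
have /(@cvg_rnormP F _ (nbhs z) (nbhs_filter z))/(_ e e0) H : id @ z --> z by [].
near=> w; rewrite -rnorm_conj sconjD sconjN !sconjK.
by near: w.
Unshelve. all: by end_near. Qed.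

Lemma smk0_continuous : continuous (fun r : R => smk r 0 : F).
Proof.
move=> r; apply/(@cvg_rnormP F _ (nbhs r) (nbhs_filter r)) => e e0.
have /cvgrPdist_lt/(_ e e0) H : id @ r --> r by [].
near=> w.
suff -> : smk r 0 - smk w 0 = smk (r - w) 0 :> F by rewrite rnorm_smk0; near: w.
by apply: sRe_inj; rewrite ?sReD ?sReN ?sRe_smk// sImD sImN !sIm_smk0 subrr.
Unshelve. all: by end_near. Qed.

End scalars.

(** * Bounded operators and the operator norm *)

Section operators.
Context {R : realType} {k : scalar_kind}.
Local Notation F := (scalar_field R k).
Context {V W : normedModType F}.

Lemma rnorm_bounded_continuous (f : {linear V -> W}) (C : R) :
  (forall v, rnorm (f v) <= C * rnorm v) -> continuous f.
Proof.
move=> fC v; apply/cvg_rnormP => e e0.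
(* [C] may be zero or negative; [|C| + 1] dominates it and can be divided by. *)
have C0 : 0 < `|C| + 1 by rewrite ltr_wpDl.
have /cvg_rnormP/(_ (e / (`|C| + 1)) (divr_gt0 e0 C0)) H : id @ v --> v by [].
near=> w; rewrite -raddfB.
have : rnorm (v - w) < e / (`|C| + 1) by near: w.
rewrite ltr_pdivlMr// => vw; apply: le_lt_trans vw.
apply: le_trans (fC _) _; rewrite mulrC; apply: ler_wpM2l; first exact: rnorm_ge0.
by rewrite (le_trans (ler_norm C))// lerDl.
Unshelve. all: by end_near. Qed.

Lemma opnorm_le (f : {linear V -> W}) (C : R) : 0 <= C ->
  (forall v, rnorm (f v) <= C * rnorm v) -> (opnorm f <= C%:E)%E.
Proof.
move=> C0 fC; apply: ge_ereal_sup => _ [v /= v1 <-]; rewrite lee_fin.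
by apply: le_trans (fC v) _; rewrite ler_piMr.
Qed.

Lemma opnorm_bound (f : {linear V -> W}) : continuous f ->
  exists C : R, [/\ opnorm f = C%:E, 0 <= C & forall v, rnorm (f v) <= C * rnorm v].
Proof.
move=> cf.
have op0 : (0 <= opnorm f)%E.
  by apply: ereal_sup_ubound; exists 0; rewrite /= ?raddf0 rnorm0 ?ler01.
have unit_le (v : V) : rnorm v <= 1 -> ((rnorm (f v))%:E <= opnorm f)%E.
  by move=> v1; apply: ereal_sup_ubound; exists v.
have homog (C : R) : (opnorm f <= C%:E)%E -> forall v, rnorm (f v) <= C * rnorm v.
  move=> fC v; have [->|v0] := eqVneq v 0; first by rewrite raddf0 !rnorm0 mulr0.
  have rv0 := rnorm_gt0 v0.
  have rvi : 0 <= (rnorm v)^-1 by rewrite invr_ge0 rnorm_ge0.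
  have := unit_le (smk (rnorm v)^-1 0 *: v).
  rewrite linearZ /= !rnormZ !rnorm_smk0 (ger0_norm rvi) mulVf ?gt_eqF//.
  move=> /(_ (lexx _)) H; have := le_trans H fC; rewrite lee_fin.
  by rewrite mulrC ler_pdivrMr.
(* Continuity at 0 gives a radius [r] below which [f] has norm less than 1. Scaling the unit ball by
   [r / 2] puts it inside that radius, whence the bound [2 / r]. *)
have [C fC] : exists C : R, (opnorm f <= C%:E)%E.
  have /cvg_rnormP/(_ 1 ltr01) := cf 0; rewrite raddf0 => /nbhs_normP[e /= e0 H].
  have [r r0 eE] := smk_gt0P e0; rewrite {}eE in H.
  exists (2 / r); apply: ge_ereal_sup => _ [v /= v1 <-]; rewrite lee_fin.
  have r2 : 0 < r / 2 by rewrite divr_gt0.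
  have := H (smk (r / 2) 0 *: v).
  rewrite /ball_ /= sub0r normrN linearZ /= sub0r rnormN normr_rnorm ltr_smk !rnormZ rnorm_smk0.
  rewrite (ger0_norm (ltW r2)).
  have -> : r / 2 * rnorm v < r.
    apply: (@le_lt_trans _ _ (r / 2)); first by rewrite ler_piMr ?(ltW r2).
    by rewrite ltr_pdivrMr// ltr_pMr// ltr1n.
  move=> /(_ isT); rewrite -ltr_pdivlMl// => /ltW/le_trans; apply.
  by rewrite mulr1 invf_div.
move: fC op0 homog; case: (opnorm f) => //= c fC; rewrite lee_fin => c0 /(_ c (lexx _)) H.
by exists c.
Qed.

End operators.

(** * Invariant mean on a compact group *)

Lemma compact_finite_cover (I : eqType) (X : topologicalType) (phi : I -> X -> X)
    (U : set X) : compact [set: X] -> open U -> (forall a, continuous (phi a)) ->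
    (forall x, exists a, U (phi a x)) ->
  exists s : seq I, forall x, exists2 a, a \in s & U (phi a x).
Proof.
move=> /compact_near_coveringP cX oU cphi Uphi.
(* Finite lists ordered by inclusion form a filter; the near-covering form of compactness along it
   yields a single list that works for all [x]. *)
pose FF : set_system (seq I) := [set P | exists s0 : seq I, forall s : seq I, {subset s0 <= s} -> P s].
have FFF : Filter FF.
  split; first by exists [::].
  - move=> P Q [s Ps] [t Qt]; exists (s ++ t) => u stu; split.
      by apply: Ps => a sa; apply: stu; rewrite mem_cat sa.
    by apply: Qt => a ta; apply: stu; rewrite mem_cat ta orbT.
  - by move=> P Q PQ [s Ps]; exists s => t st; exact/PQ/Ps.
pose covers (s : seq I) x := exists2 a, a \in s & U (phi a x).
have [|s /(_ s (fun a => id)) sU] := cX (seq I) FF covers FFF.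
  move=> x _; have [a Ua] := Uphi x.
  exists ((phi a @^-1` U), [set s : seq I | a \in s]) => /=.
    split; last by exists [:: a] => s; apply; rewrite mem_head.
    apply: open_nbhs_nbhs; split=> //.
    by apply: open_comp => // y _; exact: cphi.
  by move=> [y s] /= [Uy sa]; exists a.
by exists s => x; exact: sU.
Qed.

Section averages.
Context {R : realType}.

(** Lists may repeat entries, so a composition of averages is again an average without any weights.
    The empty list gives 0, hence the recurring assumption [0 < size s]. *)
Definition average (T : Type) (s : seq T) (f : T -> R) : R :=
  (size s)%:R^-1 * \sum_(a <- s) f a.

Lemma average_le (T : eqType) (s : seq T) (f g : T -> R) :
  (forall a, a \in s -> f a <= g a) -> average s f <= average s g.
Proof.
move=> fg; apply: ler_wpM2l; first by rewrite invr_ge0.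
by rewrite big_seq [leRHS]big_seq; apply: ler_sum.
Qed.

Lemma average_cst (T : Type) (s : seq T) (c : R) :
  (0 < size s)%N -> average s (fun=> c) = c.
Proof.
move=> s0; rewrite /average big_const_seq count_predT iter_addr_0 -[c *+ _]mulr_natl.
by rewrite mulKf// pnatr_eq0 -lt0n.
Qed.

Lemma averageC (T U : Type) (s : seq T) (t : seq U) (f : T -> U -> R) :
  average s (fun a => average t (f a)) = average t (fun b => average s (f^~ b)).
Proof.
rewrite /average -!mulr_sumr mulrCA; do 2 congr (_ * _).
exact: exchange_big.
Qed.

Lemma averageD (T : Type) (s : seq T) (f g : T -> R) r :
  average s (fun a => r * f a + g a) = r * average s f + average s g.
Proof. by rewrite /average big_split /= -mulr_sumr mulrDr mulrCA. Qed.

End averages.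

Section averages_on_groups.
Context {R : realType} {G : topologicalGroupType}.
Implicit Types (s t : seq G) (h : G -> R) (e m M c : R).

Definition ravg s h (g : G) : R := average s (fun a => h (g * a)%g).
Definition lavg s h (g : G) : R := average s (fun a => h (a * g)%g).

Lemma ravg_lavg s t h g : ravg s (lavg t h) g = lavg t (ravg s h) g.
Proof.
rewrite /ravg /lavg averageC; congr average; apply/funext => a.
by congr average; apply/funext => b; rewrite mulgA.
Qed.

Lemma ravg_comp s t h :
  ravg s (ravg t h) = ravg [seq (a * b)%g | a <- s, b <- t] h.
Proof.
apply/funext => g; rewrite /ravg /average size_allpairs big_allpairs_dep natrM invfM -mulrA.
congr (_ * _); rewrite mulr_sumr; apply: eq_bigr => a _; congr (_ * _).
by apply: eq_bigr => b _; rewrite mulgA.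
Qed.

Lemma ravg_le s h M g : (0 < size s)%N -> (forall x, h x <= M) -> ravg s h g <= M.
Proof. by move=> s0 hM; rewrite -[leRHS](average_cst M s0); apply: average_le. Qed.
Lemma ravg_ge s h M g : (0 < size s)%N -> (forall x, M <= h x) -> M <= ravg s h g.
Proof. by move=> s0 hM; rewrite -[leLHS](average_cst M s0); apply: average_le. Qed.
Lemma lavg_le s h M g : (0 < size s)%N -> (forall x, h x <= M) -> lavg s h g <= M.
Proof. by move=> s0 hM; rewrite -[leRHS](average_cst M s0); apply: average_le. Qed.
Lemma lavg_ge s h M g : (0 < size s)%N -> (forall x, M <= h x) -> M <= lavg s h g.
Proof. by move=> s0 hM; rewrite -[leLHS](average_cst M s0); apply: average_le. Qed.

Lemma ravg_dist s h c e g : (0 < size s)%N -> (forall x, `|h x - c| <= e) ->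
  `|ravg s h g - c| <= e.
Proof.
move=> s0 hc; rewrite ler_distl; apply/andP; split.
  by apply: ravg_ge => // x; have := hc x; rewrite ler_distl => /andP[].
by apply: ravg_le => // x; have := hc x; rewrite ler_distl => /andP[].
Qed.

(* Left and right averages commute, so an upper bound of a right average
   dominates every lower bound of a left average. *)
Lemma lavg_le_ravg s t h m M : (0 < size s)%N -> (0 < size t)%N ->
  (forall g, ravg s h g <= M) -> (forall g, m <= lavg t h g) -> m <= M.
Proof.
move=> s0 t0 hM hm; apply: (@le_trans _ _ (lavg t (ravg s h) 1%g)).
  by rewrite -ravg_lavg; exact: ravg_ge.
exact: lavg_le.
Qed.
Lemma ravg_le_lavg s t h m M : (0 < size s)%N -> (0 < size t)%N ->
  (forall g, m <= ravg s h g) -> (forall g, lavg t h g <= M) -> m <= M.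
Proof.
move=> s0 t0 hm hM; apply: (@le_trans _ _ (lavg t (ravg s h) 1%g)).
  exact: lavg_ge.
by rewrite -ravg_lavg; exact: ravg_le.
Qed.

Lemma continuous_mulg (T : topologicalType) (u v : T -> G) :
  continuous u -> continuous v -> continuous (fun x => (u x * v x)%g).
Proof.
move=> cu cv x; apply: (@continuous_comp _ _ _ (fun x => (u x, v x))
  (fun p : G * G => (p.1 * p.2)%g)); last exact: mulg_continuous.
by apply: cvg_pair; [exact: cu|exact: cv].
Qed.

Lemma ravg_continuous s h : continuous h -> continuous (ravg s h).
Proof.
move=> ch g; apply: cvgM; first exact: cvg_cst.
apply: (@continuous_sum R R) => a {}g; apply: continuous_comp; last exact: ch.
by apply: continuous_mulg => x; [exact: cvg_id|exact: cvg_cst].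
Qed.

Hypothesis compactG : compact [set: G].

(** Near each [x], both [h (v * x')] and [h x'] are within [e / 2] of [h x]; compactness makes the
    neighbourhood of 1 independent of [x]. The perturbation is on the left because right averages
    inherit a left modulus. *)
Lemma left_uniformly_continuous h e : continuous h -> 0 < e ->
  \forall v \near 1%g, forall x, `|h (v * x)%g - h x| <= e.
Proof.
move=> ch e0; have /compact_near_coveringP cover := compactG.
suff : \forall v \near 1%g, [set: G] `<=` (fun x => `|h (v * x)%g - h x| <= e).
  by apply: filterS => v /(_ _ I).
apply: cover => x _.
have e2 : 0 < e / 2 by rewrite divr_gt0.
have H1 : \forall x' \near x & v \near 1%g, `|h x - h (v * x')%g| < e / 2.
  have cc : continuous (fun p : G * G => h (p.2 * p.1)%g).
    move=> p; apply: (@continuous_comp _ _ _ (fun p : G * G => (p.2 * p.1)%g) h); last exact: ch.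
    by apply: continuous_mulg => -[a b]; [exact: cvg_snd|exact: cvg_fst].
  by have := cc (x, 1%g); rewrite /continuous_at/= mul1g => /cvgrPdist_lt /(_ _ e2).
have H2 : \forall x' \near x & v \near (1%g : G), `|h x - h x'| < e / 2.
  have /cvgrPdist_lt /(_ _ e2) H2 := ch x.
  by near=> x' v => /=; near: x'.
apply: filterS (filterI H1 H2) => -[x' v] /= [h1 h2].
rewrite -[h (v * x')%g](subrK (h x)) -addrA (le_trans (ler_normD _ _))//.
by rewrite [e]splitr lerD// ltW// distrC.
Unshelve. all: by end_near. Qed.

(** For an open [U] inside [V], the sets [U a^-1] cover the group, since [g] lies in the one with
    [a = g^-1]. The list depends on [V] alone. *)
Lemma finite_translates (V : set G) : nbhs 1%g V ->
  exists2 s : seq G, (0 < size s)%N & forall g, exists2 a, a \in s & V (g * a)%g.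
Proof.
rewrite nbhsE => -[U [oU U1] UV].
have [||s sU] := @compact_finite_cover G G (fun a g => (g * a)%g) U compactG oU.
- by move=> a; apply: continuous_mulg => x; [exact: cvg_id|exact: cvg_cst].
- by move=> x; exists x^-1%g; rewrite mulgV.
exists s.
  by have [a] := sU 1%g; case: (s).
by move=> g; have [a sa Ua] := sU g; exists a => //; exact: UV.
Qed.

Lemma ravg_almost_constant h e : continuous h -> 0 < e ->
  exists s c, (0 < size s)%N /\ forall g, `|ravg s h g - c| <= e.
Proof.
move=> ch e0.
have e2 : 0 < e / 2 by rewrite divr_gt0.
have [b b0 bV] := finite_translates (left_uniformly_continuous ch e2).
(* One of the [size b] terms of an average will lie [e / 2] below the upper bound, which lowers the
   average by this amount. *)
pose d := (e / 2) / (size b)%:R.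
have d0 : 0 < d by rewrite divr_gt0// ltr0n.
(* Each pass removes a fixed amount [d] from the oscillation until it drops
   below [e]: right averages keep the left modulus of continuity of [h], so
   the number of translates needed never changes. *)
have descent (j : nat) s m M : (0 < size s)%N ->
    (forall g, m <= ravg s h g <= M) -> M - m <= j%:R * d ->
    exists s' c, (0 < size s')%N /\ forall g, `|ravg s' h g - c| <= e.
  elim: j s m M => [|j IH] s m M s0 smM mM.
    exists s, m; split=> // g; have /andP[sm sM] := smM g.
    by rewrite ger0_norm ?subr_ge0//; lra.
  have [[y yM]|noy] := pselect (exists y, ravg s h y <= M - e).
    (* For every [g] some [a] in [b] puts [g * a] close to 1, so the value at [g * a * y] exceeds
       the low value at [y] by at most [e / 2] and is at most [M - e / 2]. The other terms are at
       most [M]. *)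
    pose t := [seq (a * y)%g | a <- b].
    have t0 : (0 < size t)%N by rewrite size_map.
    apply: (IH [seq (a * a')%g | a <- t, a' <- s] m (M - d)).
    - by rewrite size_allpairs muln_gt0 t0.
    - move=> g; rewrite -ravg_comp; apply/andP; split.
        by apply: ravg_ge => // x; have /andP[] := smM x.
      have [a ab Va] := bV g.
      rewrite -[leLHS]/((size t)%:R^-1 * \sum_(c <- t) ravg s h (g * c)%g) big_map size_map.
      rewrite (perm_big _ (perm_to_rem ab)) big_cons mulrDr.
      have H1 : ravg s h (g * (a * y))%g <= M - e / 2.
        have : ravg s h (g * (a * y))%g <= ravg s h y + e / 2.
          rewrite -lerBlDl.
          have -> : ravg s h (g * (a * y))%g - ravg s h y =
             ravg s (fun x => h (g * a * x)%g - h x) y.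
            rewrite -[in RHS]/(ravg _ _ _) /ravg.
            under [in RHS]eq_fun do rewrite addrC -mulN1r.
            rewrite averageD mulN1r addrC; congr (_ + _); congr average.
            by apply/funext => c; rewrite !mulgA.
          apply: ravg_le => // x; exact: le_trans (ler_norm _) (Va x).
        lra.
      have H2 : \sum_(c <- rem a b) ravg s h (g * (c * y))%g <= ((size b)%:R - 1) * M.
        rewrite -[_ - 1](_ : (size (rem a b))%:R = _); last first.
          by rewrite size_rem// -subn1 natrB.
        have -> : (size (rem a b))%:R * M = \sum_(c <- rem a b) M.
            by rewrite big_const_seq count_predT iter_addr_0 mulr_natl.
          apply: ler_sum => c _.
        by have /andP[] := smM (g * (c * y))%g.
      have n0 : 0 < (size b)%:R :> R by rewrite ltr0n.
      rewrite -mulrDr ler_pdivrMl// /d mulrBr [_ * (e / 2 / _)]mulrC divfK ?gt_eqF//.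
      move: H1 H2; lra.
    - move: mM; rewrite -natr1; lra.
  (* No value is as low as [M - e], so the average is already within [e] of [M]. *)
  exists s, M; split=> // g; have /andP[_ sM] := smM g.
  rewrite ler_distl; apply/andP; split; last lra.
  by rewrite leNgt; apply/negP => /ltW H; apply: noy; exists g.
have [B hB] : exists B, forall g, `|h g| <= B.
  have [|r [_ H]] := @compact_bounded R R (h @` [set: G]).
    by apply: continuous_compact => //; apply: continuous_subspaceT.
  exists (r + 1) => g; apply: (H (r + 1)); first by rewrite ltrDl.
  by exists g.
have [j jB] : exists j : nat, B - (- B) <= j%:R * d.
  exists (Num.bound `|(B - - B) / d|).
  rewrite -ler_pdivrMr//; apply: le_trans (ler_norm _) _; apply: ltW.
  exact: archi_boundP.
apply: (descent j [:: 1%g] (- B) B) => // g.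
by rewrite -ler_norml /ravg /average big_seq1 invr1 mul1r.
Qed.

(** Inversion exchanges the two sides: the right average of [h (x^-1)] over [s], taken at [g^-1], is
    the left average of [h] over the inverses of [s], taken at [g]. *)
Lemma lavg_almost_constant h e : continuous h -> 0 < e ->
  exists s c, (0 < size s)%N /\ forall g, `|lavg s h g - c| <= e.
Proof.
move=> ch e0.
have chV : continuous (fun g => h g^-1%g).
  by move=> g; apply: continuous_comp; [exact: invg_continuous|exact: ch].
have [s [c [s0 sc]]] := ravg_almost_constant chV e0.
exists [seq a^-1%g | a <- s], c; split; first by rewrite size_map.
move=> g; rewrite -[lavg _ _ _](_ : ravg s (fun x => h x^-1%g) g^-1%g = _); first exact: sc.
rewrite /ravg /lavg /average size_map big_map; congr (_ * _).
by apply: eq_bigr => a _; rewrite invgM invgK.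
Qed.

(* For continuous [h] this infimum is the only constant uniformly approximated
   by right averages of [h]. *)
Definition haar_mean h : R :=
  inf [set M | exists2 s, (0 < size s)%N & forall g, ravg s h g <= M].

(** A left average that is within [r / 2] of a constant [d] can be compared with every right
    average. It gives [c - e <= d + r / 2], and [d - r / 2 <= M] for every upper bound [M] competing
    in the infimum. *)
Lemma haar_mean_unique h s c e : continuous h -> (0 < size s)%N ->
  (forall g, `|ravg s h g - c| <= e) -> `|haar_mean h - c| <= e.
Proof.
move=> ch s0 sc; rewrite ler_distl.
have scl g : c - e <= ravg s h g by have := sc g; rewrite ler_distl => /andP[].
have scu g : ravg s h g <= c + e by have := sc g; rewrite ler_distl => /andP[].
apply/andP; split.
  apply: lb_le_inf; first by exists (c + e), s.
  move=> M [s' s'0 s'M]; apply/ler_addgt0Pr => r r0.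
  have r2 : 0 < r / 2 by rewrite divr_gt0.
  have [t [d [t0 td]]] := lavg_almost_constant ch r2.
  have tdl g : d - r / 2 <= lavg t h g by have := td g; rewrite ler_distl => /andP[].
  have tdu g : lavg t h g <= d + r / 2 by have := td g; rewrite ler_distl => /andP[].
  have := lavg_le_ravg s'0 t0 s'M tdl; have := ravg_le_lavg s0 t0 scl tdu; lra.
(* The infimum is over a set bounded below: a left average within 1 of a constant provides the lower
   bound. *)
apply: inf_lbound; last by exists s.
have [t [d [t0 td]]] := lavg_almost_constant ch ltr01.
have tdl g : d - 1 <= lavg t h g by have := td g; rewrite ler_distl => /andP[].
by exists (d - 1) => M [s' s'0 s'M]; exact: lavg_le_ravg s'0 t0 s'M tdl.
Qed.

Lemma haar_meanP h e : continuous h -> 0 < e ->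
  exists2 s, (0 < size s)%N & forall g, `|ravg s h g - haar_mean h| <= e.
Proof.
move=> ch e0; have e2 : 0 < e / 2 by rewrite divr_gt0.
have [s [c [s0 sc]]] := ravg_almost_constant ch e2.
exists s => // g; rewrite -(subrKA c) [e]splitr (le_trans (ler_normD _ _))// lerD//.
by rewrite distrC; exact: haar_mean_unique sc.
Qed.

(** Right averages of [ravg s h] are right averages of [h], so the constant they approximate is the
    mean of [h] by uniqueness. *)
Lemma haar_mean_ravg s h : continuous h -> (0 < size s)%N ->
  haar_mean (ravg s h) = haar_mean h.
Proof.
move=> ch s0; apply/eqP; rewrite -subr_eq0 -normr_le0; apply/ler_addgt0Pr => e e0.
rewrite add0r distrC.
have [t t0 te] := haar_meanP (@ravg_continuous s _ ch) e0.
apply: (@haar_mean_unique h [seq (a * b)%g | a <- t, b <- s]) => //.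
  by rewrite size_allpairs muln_gt0 t0.
by move=> g; rewrite -ravg_comp.
Qed.

Lemma haar_mean_translate h a : continuous h ->
  haar_mean (fun g => h (g * a)%g) = haar_mean h.
Proof.
move=> ch; rewrite -[RHS](@haar_mean_ravg [:: a])//; congr haar_mean.
by apply/funext => g; rewrite /ravg /average big_seq1 invr1 mul1r.
Qed.

(** One list serves both functions: averaging further over [t] keeps [ravg s h1] as close to its
    mean as before, while [ravg s h2] still has the mean of [h2]. *)
Lemma haar_mean_linear r h1 h2 : continuous h1 -> continuous h2 ->
  haar_mean (fun g => r * h1 g + h2 g) = r * haar_mean h1 + haar_mean h2.
Proof.
move=> ch1 ch2; apply/eqP; rewrite -subr_eq0 -normr_le0; apply/ler_addgt0Pr => e e0.
have r1 : 0 < `|r| + 1 by rewrite ltr_wpDl.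
(* Chosen so that the two errors [|r| * e'] and [e'] add up to [e]. *)
pose e' := e / (`|r| + 1).
have e'0 : 0 < e' by rewrite divr_gt0.
have [s s0 se] := haar_meanP ch1 e'0.
have [t t0 te] := haar_meanP (@ravg_continuous s _ ch2) e'0.
rewrite add0r; apply: (@haar_mean_unique _ [seq (a * b)%g | a <- t, b <- s]).
- move=> g; apply: cvgD; last exact: ch2.
  by apply: cvgM; [exact: cvg_cst|exact: ch1].
- by rewrite size_allpairs muln_gt0 t0.
move=> g; rewrite /ravg averageD -!/(ravg _ _ _) -!ravg_comp.
rewrite -(haar_mean_ravg ch2 s0) opprD addrACA -mulrBr (le_trans (ler_normD _ _))//.
have -> : e = `|r| * e' + e' by rewrite -{2}[e']mul1r -mulrDl mulrC divfK// gt_eqF.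
rewrite lerD// normrM ler_wpM2l//; exact: ravg_dist.
Qed.

Lemma haar_mean_cst c : haar_mean (fun=> c) = c.
Proof.
apply/eqP; rewrite -subr_eq0 -normr_le0.
apply: (@haar_mean_unique _ [:: 1%g]) => //; first by move=> g; exact: cvg_cst.
by move=> g; rewrite /ravg average_cst// subrr normr0.
Qed.

Lemma haar_mean_ge0 h : continuous h -> (forall g, 0 <= h g) -> 0 <= haar_mean h.
Proof.
move=> ch h0; apply/ler_addgt0Pr => e e0.
have [s s0 /(_ 1%g)] := haar_meanP ch e0.
have : 0 <= ravg s h 1%g by exact: ravg_ge.
by rewrite ler_distl => + /andP[_]; lra.
Qed.

End averages_on_groups.

(** * Hahn-Banach *)

Section hahn_banach.
Context {R : realType} {V : lmodType R} (p : V -> R).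
Hypothesis pD : forall u v, p (u + v) <= p u + p v.
Hypothesis pZ : forall (r : R) v, 0 <= r -> p (r *: v) = r * p v.

(* Partial linear functionals are handled through their graphs, that is, as
   linear subspaces of [V * R]; single-valuedness follows from domination. *)
Let dominated (A : set (V * R)) :=
  (forall r x y, A x -> A y -> A (r *: x + y)) /\
  (forall x, A x -> x.2 <= p x.1).

Let p0 : p 0 = 0. Proof. by rewrite -(scale0r 0) pZ// mul0r. Qed.

(** The one-dimensional extension step: subadditivity of [p] places every [x.2 - p (x.1 - v)] below
    every [p (y.1 + v) - y.2], and [c] is taken between them. The vector [v] may already lie in the
    domain, since domination of the larger graph is all that is asserted. *)
Let dominated_extend A v : A !=set0 -> dominated A ->
  exists2 B, dominated B & A `<=` B /\ exists c, B (v, c).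
Proof.
move=> [a0 Aa0] [Alin Ap].
have A0 : A 0 by have := Alin (-1) _ _ Aa0 Aa0; rewrite scaleN1r addNr.
have AZ r x : A x -> A (r *: x) by move=> /(Alin r _ _)/(_ A0); rewrite addr0.
pose E := [set x.2 - p (x.1 - v) | x in A].
pose c := sup E.
have Ele x y : A x -> A y -> x.2 - p (x.1 - v) <= p (y.1 + v) - y.2.
  move=> Ax Ay; have := Ap _ (Alin 1 _ _ Ax Ay); rewrite scale1r /=.
  have := pD (x.1 - v) (y.1 + v); rewrite addrACA addNr addr0; lra.
have Esup : has_sup E.
  split; first by exists ((0 : V * R).2 - p ((0 : V * R).1 - v)), 0.
  exists (p ((0 : V * R).1 + v) - (0 : V * R).2) => _ [x Ax <-]; exact: Ele.
have cl x : A x -> x.2 - p (x.1 - v) <= c.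
  by move=> Ax; apply: (ub_le_sup Esup.2); exists x.
have cu x : A x -> c <= p (x.1 + v) - x.2.
  by move=> Ax; apply: (ge_sup Esup.1) => _ [y Ay <-]; exact: Ele.
exists [set x + t *: (v, c) | x in A & t in [set: R]].
  split=> [r _ _ [x Ax [t _ <-]] [y Ay [u _ <-]]|_ [x Ax [t _ <-]]].
    exists (r *: x + y); first exact: Alin.
    by exists (r * t + u) => //; rewrite scalerDl -scalerA scalerDr addrACA.
  (* By homogeneity the case [t < 0] is the lower bound on [c] at [(- t)^-1 *: x], and the case
     [t > 0] is the upper bound at [t^-1 *: x]. *)
  have [t0|t0|->] := ltgtP t 0; last by rewrite scale0r addr0; exact: Ap.
  - have nt0 : 0 < - t by rewrite oppr_gt0.
    have := cl _ (AZ (- t)^-1 _ Ax) => /=.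
    rewrite -(ler_pM2l nt0) mulrBr -(pZ _ (ltW nt0)) scalerBr scalerA mulfV ?gt_eqF//.
    rewrite scale1r scaleNr opprK -[_^-1 *: _]/(_^-1 * _) mulVKf ?gt_eqF// mulNr.
    by rewrite -[t *: c]/(t * c); lra.
  - have := cu _ (AZ t^-1 _ Ax) => /=.
    rewrite -(ler_pM2l t0) mulrBr -(pZ _ (ltW t0)) scalerDr scalerA mulfV ?gt_eqF//.
    rewrite scale1r -[_^-1 *: _]/(_^-1 * _) mulVKf ?gt_eqF//.
    by rewrite -[t *: c]/(t * c); lra.
split; first by move=> x Ax; exists x => //; exists 0; rewrite ?scale0r ?addr0.
by exists c, 0 => //; exists 1; rewrite ?scale1r ?add0r.
Qed.

Lemma hahn_banach (W : set V) (f : V -> R) :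
  W 0 -> (forall r u v, W u -> W v -> W (r *: u + v)) ->
  (forall r u v, W u -> W v -> f (r *: u + v) = r * f u + f v) ->
  (forall v, W v -> f v <= p v) ->
  exists L : V -> R, [/\ forall r u v, L (r *: u + v) = r * L u + L v,
    forall v, W v -> L v = f v & forall v, L v <= p v].
Proof.
move=> W0 Wlin flin fp.
pose G0 : set (V * R) := [set (v, f v) | v in W].
have G0dom : dominated G0.
  split=> [r _ _ [u Wu <-] [v Wv <-]|_ [v Wv <-]]; last exact: fp.
  by exists (r *: u + v); [exact: Wlin|rewrite flin].
have [|A [HA Amax]] := @Zorn_bigcup _
    (fun A => A = set0 \/ G0 `<=` A /\ dominated A).
  move=> C CP Ctot; have [[X [CX [x Xx]]]|noX] := pselect (exists X, C X /\ X !=set0).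
    right; split; first have [X0|[G0X _]] := CP _ CX.
    - by rewrite X0 in Xx.
    - by apply: (subset_trans G0X) => y Xy; exists X.
    split=> [r y z [Y CY Yy] [Z CZ Zz]|y [Y CY Yy]]; last first.
      by have [Y0|[_ [_]]] := CP _ CY; [rewrite Y0 in Yy|exact].
    have [YZ|ZY] := Ctot _ _ CY CZ.
      exists Z => //; have [Z0|[_ [Zlin _]]] := CP _ CZ; first by rewrite Z0 in Zz.
      by apply: Zlin => //; exact: YZ.
    exists Y => //; have [Y0|[_ [Ylin _]]] := CP _ CY; first by rewrite Y0 in Yy.
    by apply: Ylin => //; exact: ZY.
  left; apply/seteqP; split=> // x [X CX Xx]; apply: noX; exists X; split=> //.
  by exists x.
have G0f v : W v -> G0 (v, f v) by exists v.
have [G0A Adom] : G0 `<=` A /\ dominated A.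
  case: HA => // A0; exfalso; apply: (Amax G0); last by right; split=> // x.
  by rewrite A0; split=> // /(_ _ (G0f 0 W0)).
have Ane : A !=set0 by exists (0, f 0); apply: G0A; exact: G0f.
have Atot v : exists c, A (v, c).
  have [B Bdom [AB [c Bvc]]] := dominated_extend v Ane Adom.
  exists c; apply: contrapT => nA; apply: (Amax B).
    by split=> // /(_ _ Bvc).
  by right; split=> //; exact: subset_trans AB.
have [Alin Ap] := Adom.
(* Two values at [v] differ by the value of the graph at 0, which is at most [p 0 = 0] in either
   order. *)
have Afun v c d : A (v, c) -> A (v, d) -> c = d.
  have le x y : A (v, x) -> A (v, y) -> y <= x.
    move=> Ax Ay; have := Ap _ (Alin (-1) _ _ Ax Ay).
    by rewrite scaleN1r /= addNr p0 addrC subr_le0.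
  by move=> Ac Ad; apply/eqP; rewrite eq_le !le.
pose L v := sval (cid (Atot v)).
have LA v : A (v, L v) by rewrite /L; case: cid.
exists L; split=> [r u v|v Wv|v].
- exact: (Afun _ _ _ (LA _) (Alin r _ _ (LA u) (LA v))).
- exact/(Afun _ _ _ (LA _))/G0A/G0f.
- exact: Ap (LA v).
Qed.

End hahn_banach.

(** * Passage from real to real or complex scalars *)

Section realification.
Context {R : realType} {k : scalar_kind} {V : lmodType (scalar_field R k)}.

(** An alias, so that scaling by [smk r 0] makes a real vector space without disturbing the given
    module structure of [V]. *)
Definition realified : Type := V.

HB.instance Definition _ := GRing.Zmodule.on realified.

Let rscale (r : R) (v : realified) : realified := (smk r 0 : scalar_field R k) *: (v : V).

Let rscaleA r s v : rscale r (rscale s v) = rscale (r * s) v.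
Proof. by rewrite /rscale scalerA -smkM. Qed.
Let rscale1 : left_id 1 rscale.
Proof.
move=> v; rewrite /rscale; have -> : smk 1 0 = 1 :> scalar_field R k by case: (k).
exact: scale1r.
Qed.
Let rscaleDr : right_distributive rscale +%R.
Proof. by move=> r u v; rewrite /rscale scalerDr. Qed.
Let rscaleDl v : {morph rscale^~ v : r s / r + s}.
Proof. by move=> r s; rewrite /rscale smkD scalerDl. Qed.

HB.instance Definition _ :=
  GRing.Zmodule_isLmodule.Build R realified rscaleA rscale1 rscaleDr rscaleDl.

Lemma realified_scaleE (r : R) (v : V) :
  r *: (v : realified) = (smk r 0 : scalar_field R k) *: v.
Proof. by []. Qed.

End realification.
Arguments realified {R k} V.

(* A real-linear extension [u] of the real part gives the scalar-linear extension
   [v |-> u v - i u (i v)]; rotating its value onto the positive axis gives the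
   bound on the absolute value. *)
Lemma hahn_banach_scalar {R : realType} {k : scalar_kind}
    (V : lmodType (scalar_field R k)) (p : V -> R) (W : set V) (f : V -> scalar_field R k) :
  (forall u v, p (u + v) <= p u + p v) ->
  (forall a v, p (a *: v) = rnorm a * p v) ->
  W 0 -> (forall a u v, W u -> W v -> W (a *: u + v)) ->
  (forall a u v, W u -> W v -> f (a *: u + v) = a * f u + f v) ->
  (forall v, W v -> rnorm (f v) <= p v) ->
  exists L : V -> scalar_field R k,
    [/\ forall a u v, L (a *: u + v) = a * L u + L v,
        forall v, W v -> L v = f v & forall v, rnorm (L v) <= p v].
Proof.
move=> pD pZ W0 Wlin flin fp.
(* The imaginary unit over the complex numbers and 0 over the reals, so the formulas below treat
   both cases at once. *)
pose I : scalar_field R k := smk 0 1.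
have WZ a v : W v -> W (a *: v) by move=> Wv; rewrite -[_ *: _]addr0; exact: Wlin.
have fZ a v : W v -> f (a *: v) = a * f v.
  have f0 : f 0 = 0.
    by have := flin (-1) _ _ W0 W0; rewrite scaleN1r addNr mulN1r addNr.
  by move=> Wv; rewrite -[a *: v]addr0 flin// f0 addr0.
have [u [ulin uf up]] : exists u : realified V -> R,
    [/\ forall (r : R) (x y : realified V), u (r *: x + y) = r * u x + u y,
        forall v, W v -> u v = sRe (f v) & forall v, u v <= p v].
  apply: (@hahn_banach R (realified V) p _ _ W (fun v => sRe (f v))) => //.
  - by move=> r v r0; rewrite realified_scaleE pZ rnorm_smk0 ger0_norm.
  - by move=> r x y Wx Wy; rewrite realified_scaleE; exact: Wlin.
  - by move=> r x y Wx Wy; rewrite realified_scaleE flin// sReD sReM_real.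
  - by move=> v Wv; apply: le_trans (fp _ Wv); apply: le_trans (sRe_norm _); exact: ler_norm.
have uD x y : u (x + y) = u x + u y by have := ulin 1 x y; rewrite scale1r mul1r.
have uZ (r : R) (x : V) : u ((smk r 0 : scalar_field R k) *: x) = r * u x.
  have u0 : u 0 = 0 by have := ulin (-1) 0 0; rewrite scaleN1r addNr mulN1r addNr.
  by have := ulin r x 0; rewrite u0 !addr0.
pose L (v : V) : scalar_field R k := smk (u v) (- u (I *: v)).
have sL v : sRe (L v) = u v by rewrite sRe_smk.
have iL v : sIm (L v) = sIm I * - u (I *: v) by rewrite /L sIm_smk.
have aE (a : scalar_field R k) : a = smk (sRe a) 0 + I * smk (sIm a) 0.
  rewrite /I; case: (k) a => [a|[a b]] /=; first by rewrite mul0r addr0.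
  by apply/eqP; rewrite eq_complex /=; apply/andP; split; apply/eqP; ring.
have II : I * I = smk (- (sIm I)) 0.
  rewrite /I; case: (k) => /=; first by rewrite mul0r oppr0.
  by apply/eqP; rewrite eq_complex /=; apply/andP; split; apply/eqP; ring.
have Llin a x y : L (a *: x + y) = a * L x + L y.
  have ua (x' : V) : u (a *: x') = sRe a * u x' + sIm a * u (I *: x').
    by rewrite {1}[a]aE scalerDl uD uZ [I * _]mulrC -scalerA uZ.
  apply: sRe_inj.
    rewrite sReD sReM !sL iL uD ua mulrA [_ * - _]mulrC.
    have -> : sIm a * sIm I = sIm a by rewrite mulrC; exact: sIm_unit.
    ring.
  rewrite sImD sImM !sL !iL scalerDr uD scalerA [I * a]mulrC -scalerA ua scalerA II uZ.
  rewrite -[in RHS](sIm_unit a) -[in RHS](sIm_unit a) -/I.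
  ring.
exists L; split=> // v.
  move=> Wv; apply: sRe_inj; first by rewrite sL uf.
  rewrite iL uf; last exact: WZ.
  rewrite fZ// sReM /I sRe_smk mul0r sub0r opprK -/I mulrA.
  have -> : sIm I * sIm I = sIm I by exact: sIm_unit.
  exact: sIm_unit.
(* Here it remains to see that [p v] is nonnegative, which follows from [0 = p (v - v) <= 2 p v]. *)
have [z0|z0] := eqVneq (L v) 0.
  rewrite z0 rnorm0; have := pD v (- v); rewrite subrr.
  rewrite -scaleN1r pZ rnormN rnorm1 mul1r.
  have -> : p 0 = 0 by rewrite -(scale0r (0 : V)) pZ rnorm0 mul0r.
  lra.
have rz := rnorm_gt0 z0.
rewrite -(ler_pM2l rz) -expr2.
have -> : rnorm (L v) ^+ 2 = u (sconj (L v) *: v).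
  rewrite -sL -[_ *: v]addr0 Llin.
  have -> : L 0 = 0.
    by have := Llin (-1) 0 0; rewrite scaleN1r addNr mulN1r addNr.
  by rewrite addr0 mulrC mul_sconj sRe_smk.
by rewrite -(rnorm_conj (L v)) -pZ.
Qed.

(** * Means of scalar-valued functions *)

(** A common interface for the invariant mean on [G] and the integral over [K]. Linearity is
    demanded on continuous functions only, where it is proved for [haar_mean]. *)
Definition is_mean {R : realType} {X : topologicalType} (m : (X -> R) -> R) : Prop :=
  [/\ forall (r : R) (h1 h2 : X -> R), continuous h1 -> continuous h2 ->
        m (fun x => r * h1 x + h2 x) = r * m h1 + m h2,
      forall h : X -> R, continuous h -> (forall x, 0 <= h x) -> 0 <= m h &
      forall c, m (fun=> c) = c].

Section mean.
Context {R : realType} {X : topologicalType} {m : (X -> R) -> R}.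
Hypothesis mean_m : is_mean m.

Lemma mean_linear (r : R) (h1 h2 : X -> R) : continuous h1 -> continuous h2 ->
  m (fun x => r * h1 x + h2 x) = r * m h1 + m h2.
Proof. by case: mean_m => + _ _; exact. Qed.

Lemma mean_ge0 (h : X -> R) : continuous h -> (forall x, 0 <= h x) -> 0 <= m h.
Proof. by case: mean_m => _ + _; exact. Qed.

Lemma mean_cst c : m (fun=> c) = c. Proof. by case: mean_m. Qed.

Lemma meanZ (r : R) (h : X -> R) : continuous h -> m (fun x => r * h x) = r * m h.
Proof.
move=> ch; have := @mean_linear r h (fun=> 0) ch _.
rewrite mean_cst addr0 => <-; first by congr m; apply/funext => x; rewrite addr0.
by move=> x; exact: cvg_cst.
Qed.

Lemma mean_le (h1 h2 : X -> R) : continuous h1 -> continuous h2 -> (forall x, h1 x <= h2 x) ->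
  m h1 <= m h2.
Proof.
move=> c1 c2 h12; rewrite -subr_ge0 addrC -mulN1r -mean_linear//.
apply: mean_ge0 => [x|x]; last by rewrite mulN1r addrC subr_ge0.
by apply: cvgD; [apply: cvgM; [exact: cvg_cst|exact: c1]|exact: c2].
Qed.

Context {k : scalar_kind}.
Local Notation F := (scalar_field R k).

Definition smean (f : X -> F) : F :=
  smk (m (fun x => sRe (f x))) (m (fun x => sIm (f x))).

Lemma continuous_sRe (f : X -> F) : continuous f -> continuous (fun x => sRe (f x)).
Proof. by move=> cf x; apply: continuous_comp; [exact: cf|exact: sRe_continuous]. Qed.

Lemma continuous_sIm (f : X -> F) : continuous f -> continuous (fun x => sIm (f x)).
Proof. by move=> cf x; apply: continuous_comp; [exact: cf|exact: sIm_continuous]. Qed.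

Lemma continuous_rnorm {V : normedModType F} (f : X -> V) :
  continuous f -> continuous (fun x => rnorm (f x)).
Proof. by move=> cf x; apply: continuous_comp; [exact: cf|exact: rnorm_continuous]. Qed.

Lemma continuous_sconj (f : X -> F) : continuous f -> continuous (fun x => sconj (f x)).
Proof. by move=> cf x; apply: continuous_comp; [exact: cf|exact: sconj_continuous]. Qed.

Lemma sRe_smean f : sRe (smean f) = m (fun x => sRe (f x)).
Proof. exact: sRe_smk. Qed.

Lemma sIm_smean (f : X -> F) : continuous f -> sIm (smean f) = m (fun x => sIm (f x)).
Proof.
move=> cf; rewrite /smean sIm_smk -meanZ; last exact: continuous_sIm.
by congr m; apply/funext => x; rewrite sIm_unit.
Qed.

Lemma continuous_lin (a : F) (f g : X -> F) : continuous f -> continuous g ->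
  continuous (fun x => a * f x + g x).
Proof.
move=> cf cg x; apply: cvgD; last exact: cg.
by apply: cvgM; [exact: cvg_cst|exact: cf].
Qed.

Lemma smean_linear a (f g : X -> F) : continuous f -> continuous g ->
  smean (fun x => a * f x + g x) = a * smean f + smean g.
Proof.
move=> cf cg; have cl := @continuous_lin a _ _ cf cg.
have [rf ig] := (continuous_sRe cf, continuous_sIm cg).
have [jf rg] := (continuous_sIm cf, continuous_sRe cg).
apply: sRe_inj.
  rewrite sReD sReM !sRe_smean sIm_smean// -addrA -mulNr -!mean_linear//.
    by congr m; apply/funext => x; rewrite sReD sReM; ring.
  by move=> x; apply: cvgD; [apply: cvgM; [exact: cvg_cst|exact: jf]|exact: rg].
rewrite sImD sImM !sIm_smean// sRe_smean -addrA -!mean_linear//.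
  by congr m; apply/funext => x; rewrite sImD sImM; ring.
by move=> x; apply: cvgD; [apply: cvgM; [exact: cvg_cst|exact: rf]|exact: ig].
Qed.

Lemma smean_cst c : smean (fun=> c) = c.
Proof. by rewrite /smean !mean_cst smkE. Qed.

Lemma smeanZ a (f : X -> F) : continuous f -> smean (fun x => a * f x) = a * smean f.
Proof.
move=> cf; have := @smean_linear a f (fun=> 0) cf _.
rewrite smean_cst addr0 => <-; first by congr smean; apply/funext => x; rewrite addr0.
by move=> x; exact: cvg_cst.
Qed.

Lemma smeanD (f g : X -> F) : continuous f -> continuous g ->
  smean (fun x => f x + g x) = smean f + smean g.
Proof.
move=> cf cg; have := smean_linear 1 cf cg; rewrite mul1r => <-.
by congr smean; apply/funext => x; rewrite mul1r.
Qed.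

Lemma smean_sum (I : Type) (s : seq I) (f : I -> X -> F) :
  (forall i, continuous (f i)) ->
  smean (fun x => \sum_(i <- s) f i x) = \sum_(i <- s) smean (f i).
Proof.
move=> cf; elim: s => [|i s IH].
  rewrite big_nil -[RHS]smean_cst; congr smean; apply/funext => x.
  by rewrite big_nil.
rewrite big_cons -IH -smeanD//; last exact: continuous_sum.
by congr smean; apply/funext => x; rewrite big_cons.
Qed.

Lemma smean_conj (f : X -> F) : continuous f ->
  smean (fun x => sconj (f x)) = sconj (smean f).
Proof.
move=> cf; have cc := continuous_sconj cf; apply: sRe_inj.
  by rewrite sRe_conj !sRe_smean; congr m; apply/funext => x; rewrite sRe_conj.
rewrite sIm_conj !sIm_smean// -mulN1r -meanZ; last exact: continuous_sIm.
by congr m; apply/funext => x; rewrite sIm_conj mulN1r.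
Qed.

Lemma smean_smk0 (h : X -> R) : smean (fun x => smk (h x) 0) = smk (m h) 0.
Proof.
rewrite /smean; congr smk; first by congr m; apply/funext => x; rewrite sRe_smk.
by rewrite -[RHS]mean_cst; congr m; apply/funext => x; rewrite sIm_smk0.
Qed.

(* Rotating the mean [z] of [f] onto the positive axis gives
   [|z|^2 = Re (m (conj z * f)) <= |z| * m |f|]. *)
Lemma rnorm_smean (f : X -> F) : continuous f ->
  rnorm (smean f) <= m (fun x => rnorm (f x)).
Proof.
move=> cf; have cn := continuous_rnorm cf.
have [z0|z0] := eqVneq (smean f) 0.
  by rewrite z0 rnorm0; apply: mean_ge0 => // x; exact: rnorm_ge0.
rewrite -(ler_pM2l (rnorm_gt0 z0)) -meanZ// -expr2.
have -> : rnorm (smean f) ^+ 2 = sRe (smean (fun x => sconj (smean f) * f x)).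
  by rewrite smeanZ// mulrC mul_sconj sRe_smk.
rewrite sRe_smean; apply: mean_le.
- apply: continuous_sRe => x; apply: cvgM; [exact: cvg_cst|exact: cf].
- by move=> x; apply: cvgM; [exact: cvg_cst|exact: cn].
- move=> x; rewrite -(rnorm_conj (smean f)) -rnormM.
  by apply: le_trans (sRe_norm _); exact: ler_norm.
Qed.

Lemma rnorm_smean_le (f : X -> F) c : continuous f -> (forall x, rnorm (f x) <= c) ->
  rnorm (smean f) <= c.
Proof.
move=> cf fc; apply: le_trans (rnorm_smean cf) _; rewrite -[leRHS]mean_cst.
by apply: mean_le => //; [exact: continuous_rnorm|move=> x; exact: cvg_cst].
Qed.

End mean.
Arguments smean {R X} m {k} f.

Lemma haar_mean_is_mean {R : realType} {G : topologicalGroupType} :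
  compact [set: G] -> is_mean (@haar_mean R G).
Proof.
move=> cG; split=> [r h1 h2|h|c].
- exact: haar_mean_linear.
- exact: haar_mean_ge0.
- exact: haar_mean_cst.
Qed.

(** * The invariant integral on the homogeneous space *)

Section integral.
Context {R : realType} {K : compactHausdorffType} (mu : probability (borel K) R).

Definition imean (h : K -> R) : R := \int[mu]_x h x.

Lemma continuous_measurable (h : K -> R) : continuous h ->
  measurable_fun setT (h : borel K -> R).
Proof.
move=> ch; apply: (measurability _ (measurable_realfun.RGenOpens.measurableE R)).
move=> _ [_ [a [b ->] <-]]; rewrite setTI; apply: sub_sigma_algebra.
by have /continuousP := ch; apply; exact: interval_open.
Qed.

Lemma continuous_integrable (h : K -> R) : continuous h ->
  mu.-integrable setT (EFin \o (h : borel K -> R)).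
Proof.
move=> ch; apply: measurable_bounded_integrable => //=.
- by rewrite probability_setT ltry.
- exact: continuous_measurable.
(* Seen as an element of the real [C(K)], [h] is bounded by its supremum norm. *)
pose f : ctsfun R RealScalars K := @CtsFun R RealScalars K h ch.
exists (supnorm f); split; first exact: num_real.
move=> r fr x _ /=; apply: le_trans (ltW fr).
exact: (supnorm_upper f x).
Qed.

Lemma imean_is_mean : is_mean imean.
Proof.
split=> [r h1 h2 c1 c2|h _ h0|c].
- have crh : continuous (fun x => r * h1 x).
    by move=> x; apply: cvgM; [exact: cvg_cst|exact: c1].
  rewrite /imean RintegralD//; [|exact: continuous_integrable..].
  by congr (_ + _); rewrite RintegralZl//; exact: continuous_integrable.
- by apply: Rintegral_ge0 => x _; exact: h0.
- transitivity (c * fine (1%:E)); last exact: mulr1.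
  rewrite /imean Rintegral_cst//; congr (_ * fine _).
  exact: (@probability_setT _ _ _ mu).
Qed.

Lemma EFin_imean (h : K -> R) : continuous h -> (\int[mu]_x (h x)%:E)%E = (imean h)%:E.
Proof.
move=> ch; rewrite /imean /Rintegral fineK//.
by apply: integrable_fin_num => //; exact: continuous_integrable.
Qed.

Context {G : topologicalGroupType} {act : homogeneous_action G K}.
Hypothesis mu_invariant : invariant_measure mu act.

Lemma action_fixed_continuous g : continuous (act g).
Proof.
move=> x; apply: (@continuous_comp _ _ _ (fun x : K => (g, x))
  (fun p : G * K => act p.1 p.2)); last exact: action_continuous.
by apply: cvg_pair; [exact: cvg_cst|exact: cvg_id].
Qed.

Lemma actKV g x : act g (act g^-1%g x) = x.
Proof. by rewrite -actionM mulgV action1. Qed.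
Lemma actK g x : act g^-1%g (act g x) = x.
Proof. by rewrite -actionM mulVg action1. Qed.

(** The push-forward of [mu] under [act g] is [mu]: a preimage under [g] is an image under [g^-1],
    and invariance is stated for images. *)
Lemma imean_action g (h : K -> R) : continuous h -> imean (fun x => h (act g x)) = imean h.
Proof.
move=> ch.
have mact : measurable_fun setT (act g : borel K -> borel K).
  apply: (@measurability _ _ (borel K) (borel K) setT (act g) (@open K) (erefl _)) => _ [U oU <-].
  rewrite setTI; apply: sub_sigma_algebra.
  by have /continuousP := @action_fixed_continuous g; apply.
have cga : continuous (fun x => h (act g x)).
  by move=> x; apply: continuous_comp; [exact: action_fixed_continuous|exact: ch].
apply: EFin_inj; rewrite -!EFin_imean//.
rewrite -(@integral_pushforward _ _ (borel K) (borel K) R (act g) mact mu setT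
  (fun x => (h x)%:E))//.
- have imE (A : set (borel K)) : act g @^-1` A = act g^-1%g @` A.
    apply/seteqP; split=> x /=; first by move=> Ax; exists (act g x) => //; rewrite actK.
    by move=> [y Ay <-]; rewrite actKV.
  apply: eq_measure_integral => A mA _.
  by rewrite /= /pushforward imE mu_invariant.
- by apply/measurable_realfun.measurable_EFinP; exact: continuous_measurable.
- exact: continuous_integrable.
Qed.

(* Finitely many translates of [h] add up to a function bounded below. *)
Lemma imean_gt0 (h : K -> R) y : continuous h -> (forall x, 0 <= h x) -> 0 < h y ->
  0 < imean h.
Proof.
move=> ch h0 hy.
pose U := [set x | h y / 2 < h x].
have oU : open U by apply: (@open_comp _ _ h [set z | h y / 2 < z]); [move=> x _; exact: ch|exact: open_gt].
have [||s sU] := @compact_finite_cover G K (fun g => act g) U (@compact_setT K) oU.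
- exact: action_fixed_continuous.
- move=> x; have [g gxy] := action_transitive act x y; exists g.
  by rewrite /U /= gxy ltr_pdivrMr// ltr_pMr// ltr1n.
have cact g : continuous (fun x => h (act g x)).
  by move=> x; apply: continuous_comp; [exact: action_fixed_continuous|exact: ch].
have msum t : imean (fun x => \sum_(g <- t) h (act g x)) = (size t)%:R * imean h.
  elim: t => [|g t IH].
    rewrite mul0r -[RHS](mean_cst imean_is_mean); congr imean; apply/funext => x.
    by rewrite big_nil.
  rewrite /= -natr1 mulrDl mul1r -IH addrC -[imean h]mul1r -(imean_action g ch).
  rewrite -(mean_linear imean_is_mean)//; last exact: (@continuous_sum R R).
  by congr imean; apply/funext => x; rewrite big_cons mul1r.
have : 0 < (size s)%:R * imean h.
  rewrite -msum; apply: (@lt_le_trans _ _ (h y / 2)); first by rewrite divr_gt0.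
  rewrite -[leLHS](mean_cst imean_is_mean).
  apply: (mean_le imean_is_mean) => [x|//|x]; [exact: cvg_cst|exact: (@continuous_sum R R)|].
  have [g gs Ug] := sU x; rewrite (perm_big _ (perm_to_rem gs)) big_cons /=.
  by rewrite ler_wpDr ?(ltW Ug)// sumr_ge0.
by rewrite pmulr_rgt0// ltr0n; case: (s) (sU y) => // -[].
Qed.

End integral.

(** * Orthonormal bases and the reproducing kernel *)

Section spans.
Context {R : realType} {k : scalar_kind} {V : lmodType (scalar_field R k)}.
Local Notation F := (scalar_field R k).

Lemma spans_mem n (e : 'I_n -> V) S j : spans e S -> S (e j).
Proof.
move=> ->; exists (fun i => (i == j)%:R).
rewrite (bigD1 j)//= eqxx scale1r big1 ?addr0// => i ij.
by rewrite (negbTE ij) scale0r.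
Qed.

Lemma spans_sum n (e : 'I_n -> V) S (c : 'I_n -> F) : spans e S -> S (\sum_j c j *: e j).
Proof. by move=> ->; exists c. Qed.

Lemma spans0 n (e : 'I_n -> V) S : spans e S -> S 0.
Proof. by move=> ->; exists (fun=> 0); rewrite big1// => j _; rewrite scale0r. Qed.

Lemma spans_lin n (e : 'I_n -> V) S a u v : spans e S -> S u -> S v -> S (a *: u + v).
Proof.
move=> -> [c ->] [d ->]; exists (fun j => a * c j + d j).
by rewrite scaler_sumr -big_split; apply: eq_bigr => j _; rewrite scalerDl scalerA.
Qed.

End spans.

Lemma continuous_sqr {R : realType} {X : topologicalType} (h : X -> R) :
  continuous h -> continuous (fun x => h x ^+ 2).
Proof.
move=> ch; under eq_fun do rewrite expr2.
by move=> x; apply: cvgM; exact: ch.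
Qed.

Section L2_inner_product.
Context {R : realType} {k : scalar_kind} {K : compactHausdorffType}.
Context (mu : probability (borel K) R).
Local Notation F := (scalar_field R k).
Local Notation C := (ctsfun R k K).
Implicit Types f g h : C.

Lemma rnorm_supnorm f : rnorm f = supnorm f. Proof. exact: rnorm_ctsfunE. Qed.

Lemma rnorm_eval f x : rnorm (f x) <= rnorm f.
Proof. by rewrite rnorm_supnorm; exact: supnorm_upper. Qed.

Lemma rnorm_ctsfun_le f r : (forall x, rnorm (f x) <= r) -> rnorm f <= r.
Proof. by rewrite rnorm_supnorm; exact: supnorm_least. Qed.

Lemma ctsfun_sumE (I : Type) (s : seq I) (f : I -> C) x :
  (\sum_(j <- s) f j : C) x = \sum_(j <- s) f j x.
Proof. exact: (big_morph (fun f : C => f x)). Qed.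

Local Notation inn := (@inner_L2 R k K mu).
Let mmu := imean_is_mean mu.

Lemma inner_continuous f g : continuous (fun x => f x * sconj (g x)).
Proof.
move=> x; apply: cvgM; first exact: ctsfun_continuous.
exact: (continuous_sconj (@ctsfun_continuous _ _ _ g)).
Qed.

Lemma inner_smean f g : inn f g = smean (imean mu) (fun x => f x * sconj (g x)).
Proof. by []. Qed.

Lemma inner_linear a f g h : inn (a *: f + g : C) h = a * inn f h + inn g h.
Proof.
rewrite !inner_smean -(smean_linear mmu); [|exact: inner_continuous..].
by congr smean; apply/funext => x /=; rewrite mulrDl mulrA.
Qed.

Lemma inner_sym f g : inn g f = sconj (inn f g).
Proof.
rewrite !inner_smean -(smean_conj mmu); last exact: inner_continuous.
by congr smean; apply/funext => x; rewrite sconjM sconjK mulrC.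
Qed.

Lemma inner0l h : inn (0 : C) h = 0.
Proof.
have := inner_linear (-1) h h h; rewrite mulN1r addNr => <-.
by rewrite scaleN1r addNr.
Qed.

Lemma innerZl a f h : inn (a *: f : C) h = a * inn f h.
Proof. by rewrite -[a *: f]addr0 inner_linear inner0l addr0. Qed.

Lemma innerDl f g h : inn (f + g : C) h = inn f h + inn g h.
Proof. by rewrite -[f]scale1r inner_linear scale1r mul1r. Qed.

Lemma innerBl f g h : inn (f - g : C) h = inn f h - inn g h.
Proof. by rewrite -scaleN1r innerDl innerZl mulN1r. Qed.

Lemma innerBr f g h : inn f (g - h : C) = inn f g - inn f h.
Proof. by rewrite inner_sym innerBl sconjD sconjN -!inner_sym. Qed.

Lemma inner_suml n (f : 'I_n -> C) h : inn (\sum_j f j : C) h = \sum_j inn (f j) h.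
Proof.
by rewrite (big_morph (fun f : C => inn f h) (fun f g => innerDl f g h) (inner0l h)).
Qed.

Lemma inner_sumr n (c : 'I_n -> F) (e : 'I_n -> C) f :
  inn f (\sum_j c j *: e j : C) = \sum_j sconj (c j) * inn f (e j).
Proof.
rewrite inner_sym inner_suml sconj_sum; apply: eq_bigr => j _.
by rewrite innerZl sconjM -inner_sym.
Qed.

Lemma inner_self f : inn f f = smk (imean mu (fun x => rnorm (f x) ^+ 2)) 0.
Proof.
rewrite inner_smean -(smean_smk0 mmu); congr smean; apply/funext => x.
exact: mul_sconj.
Qed.

Lemma rnorm_inner f g : rnorm (inn f g) <= rnorm f * rnorm g.
Proof.
apply: (rnorm_smean_le mmu) => [|x]; first exact: inner_continuous.
rewrite rnormM rnorm_conj; apply: ler_pM; rewrite ?rnorm_ge0//; exact: rnorm_eval.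
Qed.

Section invariant.
Context {G : topologicalGroupType} {act : homogeneous_action G K}.
Hypothesis mu_invariant : invariant_measure mu act.

(** By [imean_gt0] the invariant measure charges every nonnegative continuous function that is
    positive somewhere, so a vanishing [L_2] norm forces [f = 0] at every point and not just almost
    everywhere. *)
Lemma inner_definite f : inn f f = 0 -> f = 0.
Proof.
rewrite inner_self => /(congr1 sRe); rewrite sRe_smk sRe0 => m0.
apply/ctsfunP => y; apply: rnorm0_eq0; apply/eqP; rewrite -sqrf_eq0.
have := sqr_ge0 (rnorm (f y)); rewrite le_eqVlt => /predU1P[<-//|fy].
have := imean_gt0 mu_invariant (h := fun x => rnorm (f x) ^+ 2) (y := y).
rewrite m0 ltxx => H; exfalso; suff : false by [].
apply: H => // [|x]; last exact: sqr_ge0.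
exact: (continuous_sqr (continuous_rnorm (@ctsfun_continuous _ _ _ f))).
Qed.

Lemma inner_translate (a : G) f h : inn (translate act a f) (translate act a h) = inn f h.
Proof.
have cfh := @inner_continuous f h.
rewrite !inner_smean /smean.
rewrite -(imean_action mu_invariant a^-1%g (continuous_sRe cfh)).
by rewrite -(imean_action mu_invariant a^-1%g (continuous_sIm cfh)).
Qed.

(** The vectors [e] may be dependent, hence the separate length [m]. With [w] the component of
    [e ord0] orthogonal to the span of the others, [w = 0] adds nothing and otherwise [w] is
    normalized and added. *)
Lemma gram_schmidt n (e : 'I_n -> C) : exists m (b : 'I_m -> C),
  orthonormal_basis mu [set v | exists c : 'I_n -> F, v = \sum_j c j *: e j] b.
Proof.
elim: n e => [|n IH] e.
  exists 0%N, (fun=> 0); split; first by case.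
  by apply/seteqP; split=> f [c ->]; exists (fun=> 0); rewrite !big_ord0.
have [m [b [bon]]] := IH (e \o lift ord0).
set T := [set v | _] => Tb.
have eE : [set v | exists c : 'I_n.+1 -> F, v = \sum_j c j *: e j] =
    [set v | exists a t, T t /\ v = a *: e ord0 + t].
  apply/seteqP; split=> f.
    move=> [c ->]; rewrite big_ord_recl; exists (c ord0), (\sum_(j < n) c (lift ord0 j) *: e (lift ord0 j)).
    by split=> //; exists (c \o lift ord0).
  move=> [a [_ [[c ->] ->]]].
  exists (fun j => if unlift ord0 j is Some j' then c j' else a).
  rewrite big_ord_recl unlift_none; congr (_ + _); apply: eq_bigr => j _.
  by rewrite liftK.
rewrite eE; set v := e ord0.
pose w : C := v - \sum_j inn v (b j) *: b j.
have wb j : inn w (b j) = 0.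
  rewrite innerBl inner_suml (bigD1 j)//= innerZl bon eqxx mulr1 big1 ?addr0 ?subrr// => i ij.
  by rewrite innerZl bon (negbTE ij) mulr0.
have Tsum (c : 'I_m -> F) : T (\sum_j c j *: b j) by exact: spans_sum.
have [w0|w0] := eqVneq w 0.
  exists m, b; split=> //; rewrite /spans -Tb.
  have Tv : T v by move/eqP: w0; rewrite subr_eq0 => /eqP ->.
  apply/seteqP; split=> [_ [a [t [Tt ->]]]|t Tt]; first exact: (spans_lin _ Tb).
  by exists 0, t; rewrite scale0r add0r.
pose r := Num.sqrt (imean mu (fun x => rnorm (w x) ^+ 2)).
have r0 : 0 < r.
  rewrite sqrtr_gt0 lt_neqAle; apply/andP; split.
    apply: contra w0 => /eqP w0; apply/eqP/inner_definite.
    by rewrite inner_self -w0 smk00.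
  apply: (mean_ge0 mmu) => [|x]; last exact: sqr_ge0.
  exact: (continuous_sqr (continuous_rnorm (@ctsfun_continuous _ _ _ w))).
have rE : inn w w = smk (r ^+ 2) 0.
  rewrite inner_self sqr_sqrtr//; apply: ltW; rewrite -sqrtr_gt0; exact: r0.
pose s : F := smk r^-1 0.
have sr : s * smk r 0 = 1 :> F.
  rewrite -smkM mulVf ?gt_eqF//; by case: (k).
have sc : sconj s = s.
  by apply: sRe_inj; rewrite ?sRe_conj ?sIm_conj// sIm_smk0 oppr0.
pose u : C := s *: w.
pose b' (i : 'I_m.+1) : C := if unlift ord0 i is Some j then b j else u.
have b'0 : b' ord0 = u by rewrite /b' unlift_none.
have b'S j : b' (lift ord0 j) = b j by rewrite /b' liftK.
have ub j : inn u (b j) = 0 by rewrite innerZl wb mulr0.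
exists m.+1, b'; split=> [i j|].
  case: (unliftP ord0 i) => [i' ->|->]; case: (unliftP ord0 j) => [j' ->|->].
  - by rewrite !b'S bon (inj_eq lift_inj).
  - by rewrite b'S b'0 inner_sym ub sconj0.
  - by rewrite b'S b'0 ub.
  - rewrite b'0 innerZl inner_sym innerZl rE sconjM sc.
    have -> : sconj (smk (r ^+ 2) 0 : F) = smk (r ^+ 2) 0.
      by apply: sRe_inj; rewrite ?sRe_conj ?sIm_conj// sIm_smk0 oppr0.
    by rewrite expr2 smkM (mulrA s (smk r 0)) sr mul1r sr eqxx.
have vE : v = (smk r 0 : F) *: u + \sum_j inn v (b j) *: b j.
  by rewrite scalerA [smk r 0 * s]mulrC sr scale1r subrK.
apply/seteqP; split=> [_ [a [t [Tt ->]]]|_ [c ->]]; last first.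
  rewrite big_ord_recl b'0; under eq_bigr do rewrite b'S.
  exists (c ord0 * s), (- (c ord0 * s) *: (\sum_j inn v (b j) *: b j) + \sum_j c (lift ord0 j) *: b j).
  split; first by apply: (spans_lin _ Tb); exact: Tsum.
  by rewrite addrA scaleNr -scalerBr scalerA.
have : T (a *: (\sum_j inn v (b j) *: b j) + t) by exact: (spans_lin _ Tb).
rewrite Tb => -[c cE].
exists (fun i => if unlift ord0 i is Some j then c j else a * smk r 0).
rewrite big_ord_recl b'0 unlift_none.
under eq_bigr do rewrite liftK b'S.
by rewrite -cE -scalerA addrA -scalerDr -vE.
Qed.

Lemma orthonormal_basis_exists S : finite_dimensional S ->
  exists n (e : 'I_n -> C), orthonormal_basis mu S e.
Proof. by move=> [n [e ->]]; exact: gram_schmidt. Qed.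

Lemma inner_basis S n (e : 'I_n -> C) (c : 'I_n -> F) i : orthonormal_basis mu S e ->
  inn (\sum_j c j *: e j : C) (e i) = c i.
Proof.
move=> [eon _]; rewrite inner_suml (bigD1 i)//= innerZl eon eqxx mulr1 big1 ?addr0// => j ji.
by rewrite innerZl eon (negbTE ji) mulr0.
Qed.

(** The choice in [orth_proj] is forced: the difference of two candidates lies in [S] and is
    orthogonal to [S], hence to itself. *)
Lemma orth_projE S n (e : 'I_n -> C) f : orthonormal_basis mu S e ->
  orth_proj mu S f = \sum_j inn f (e j) *: e j.
Proof.
move=> one; have [_ Se] := one; apply: xget_unique.
  split; first exact: spans_sum.
  rewrite {1}Se => _ [c ->].
  have -> : (fun x => f x - (\sum_j inn f (e j) *: e j : C) x) =
    (f - \sum_j inn f (e j) *: e j : C) by [].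
  rewrite inner_sumr big1// => i _.
  by rewrite innerBl (inner_basis _ _ one) subrr mulr0.
move=> h [Sh ho].
have hS : S (\sum_j inn f (e j) *: e j) by exact: spans_sum.
apply/eqP; rewrite -subr_eq0; apply/eqP; apply: inner_definite.
set p := \sum_j _ in hS *.
have Shp : S (h - p).
  by rewrite addrC -scaleN1r; exact: (spans_lin _ Se).
have := ho _ Shp.
have -> : (fun x => f x - h x) = (f - h : C) by [].
have : inn (f - p : C) (h - p : C) = 0.
  move: Shp; rewrite {1}Se => -[c ->]; rewrite inner_sumr big1// => i _.
  by rewrite innerBl (inner_basis _ _ one) subrr mulr0.
have hpE : h - p = (f - p) - (f - h) by rewrite opprB [RHS]addrC subrKA.
by move=> fp fh; rewrite {1}hpE innerBl fp fh subrr.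
Qed.

Lemma translate_basis S n (e : 'I_n -> C) (g : G) : invariant_subspace act S ->
  orthonormal_basis mu S e -> orthonormal_basis mu S (fun j => translate act g (e j)).
Proof.
move=> Sinv [eon Se]; split=> [i j|]; first by rewrite inner_translate.
have tE c (b : 'I_n -> C) : translate act g (\sum_j c j *: b j) = \sum_j c j *: translate act g (b j).
  by apply/ctsfunP => x; rewrite [LHS]ctsfun_sumE ctsfun_sumE.
apply/seteqP; split=> f.
  move=> Sf; have := Sinv g^-1%g _ Sf; rewrite {1}Se => -[c cE].
  exists c; rewrite -tE -cE; apply/ctsfunP => x /=.
  by rewrite invgK actKV.
by move=> [c ->]; rewrite -tE; apply: Sinv; exact: spans_sum.
Qed.

(** * The reproducing kernel and the norm of the orthogonal projection *)

Section kernel.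
Context {S : set C} {n : nat} {e : 'I_n -> C}.
Hypothesis (one : orthonormal_basis mu S e) (Sinv : invariant_subspace act S).
Local Notation ker := (basis_kernel e).

Lemma kernel_continuous x : continuous (ker x).
Proof.
apply: (@continuous_sum F F K 'I_n _ (fun j y => sconj (e j x) * e j y)) => j y.
by apply: cvgM; [exact: cvg_cst|exact: ctsfun_continuous].
Qed.

(** The kernel does not depend on the basis, so it may be computed in the basis translated by [g],
    whose values at [act g x] are the [e j x]. *)
Lemma kernel_invariant (g : G) x y : ker (act g x) (act g y) = ker x y.
Proof.
have E : basis_kernel (fun j => translate act g (e j)) = ker.
  by rewrite -(rep_kernelE one) (rep_kernelE (translate_basis g Sinv one)).
by rewrite -[in LHS]E; apply: eq_bigr => j _ /=; rewrite !actK.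
Qed.

Lemma kernel_norm_indep x y :
  imean mu (fun z => rnorm (ker x z)) = imean mu (fun z => rnorm (ker y z)).
Proof.
have [g <-] := action_transitive act x y.
rewrite -(imean_action mu_invariant g (continuous_rnorm (@kernel_continuous (act g x)))).
by congr imean; apply/funext => z; rewrite kernel_invariant.
Qed.

Lemma orth_proj_kernel f x :
  orth_proj mu S f x = smean (imean mu) (fun y => f y * sconj (ker x y)).
Proof.
rewrite (orth_projE _ one) ctsfun_sumE.
transitivity (smean (imean mu) (fun y => \sum_j e j x * (f y * sconj (e j y)))).
  rewrite (smean_sum mmu) => [|j].
    apply: eq_bigr => j _; rewrite (smeanZ mmu (e j x) (@inner_continuous f (e j))).
    exact: mulrC.
  by move=> y; apply: cvgM; [exact: cvg_cst|exact: inner_continuous].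
congr smean; apply/funext => y; rewrite sconj_sum mulr_sumr.
by apply: eq_bigr => j _; rewrite sconjM sconjK mulrCA.
Qed.

Lemma rnorm_orth_proj f x0 :
  rnorm (orth_proj mu S f) <= imean mu (fun y => rnorm (ker x0 y)) * rnorm f.
Proof.
apply: rnorm_ctsfun_le => x; rewrite orth_proj_kernel.
have cker := continuous_rnorm (@kernel_continuous x).
have cint : continuous (fun y => f y * sconj (ker x y)).
  move=> y; apply: cvgM; first exact: ctsfun_continuous.
  exact: (continuous_sconj (@kernel_continuous x)).
apply: le_trans (rnorm_smean mmu cint) _.
rewrite (kernel_norm_indep x0 x) mulrC -(meanZ mmu)//.
apply: (mean_le mmu); first exact: continuous_rnorm.
  by move=> y; apply: cvgM; [exact: cvg_cst|exact: cker].
move=> y; rewrite rnormM rnorm_conj ler_wpM2r ?rnorm_ge0//; exact: rnorm_eval.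
Qed.

(* The lower bound tests the projection on [k / (|k| + r)], a continuous
   substitute for the sign of the kernel [k] that is almost optimal for small [r]. *)
Lemma opnorm_orth_proj x0 : opnorm (fun f : C => orth_proj mu S f) =
  (imean mu (fun y => rnorm (ker x0 y)))%:E.
Proof.
set N := imean mu _; apply/eqP; rewrite eq_le; apply/andP; split.
  apply: ge_ereal_sup => _ [f /= f1 <-]; rewrite lee_fin.
  apply: le_trans (rnorm_orth_proj f x0) _; rewrite ler_piMr//.
  apply: (mean_ge0 mmu) => [|y]; last exact: rnorm_ge0.
  exact: (continuous_rnorm (@kernel_continuous x0)).
apply/lee_addgt0Pr => r r0.
have cker := @kernel_continuous x0; have crker := continuous_rnorm cker.
have d0 y : 0 < rnorm (ker x0 y) + r by rewrite ltr_wpDl ?rnorm_ge0.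
have cd : continuous (fun y => (rnorm (ker x0 y) + r)^-1).
  move=> y; apply: cvgV; first by rewrite gt_eqF.
  by apply: cvgD; [exact: crker|exact: cvg_cst].
have cf : continuous (fun y => ker x0 y * smk (rnorm (ker x0 y) + r)^-1 0).
  move=> y; apply: cvgM; first exact: cker.
  apply: (@continuous_comp _ _ _ (fun y => (rnorm (ker x0 y) + r)^-1)
    (fun r : R => smk r 0 : F)); [exact: cd|exact: smk0_continuous].
pose f : C := CtsFun cf.
have f1 : rnorm f <= 1.
  apply: rnorm_ctsfun_le => y /=; rewrite rnormM rnorm_smk0.
  rewrite ger0_norm ?invr_ge0 ?(ltW (d0 y))// ler_pdivrMr// mul1r.
  by rewrite lerDl ltW.
apply: (@le_trans _ _ ((rnorm (orth_proj mu S f x0))%:E + r%:E)%E); last first.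
  rewrite leeD2r//; apply: le_trans (_ : (rnorm (orth_proj mu S f))%:E <= _)%E.
    by rewrite lee_fin; exact: rnorm_eval.
  by apply: ereal_sup_ubound; exists f.
rewrite -EFinD lee_fin -lerBlDr orth_proj_kernel.
pose h y := rnorm (ker x0 y) ^+ 2 * (rnorm (ker x0 y) + r)^-1.
(* Against this test function the integrand is the nonnegative real [|k|^2 / (|k| + r)]. *)
have -> : (fun y => f y * sconj (ker x0 y)) = (fun y => smk (h y) 0).
  by apply/funext => y; rewrite /= mulrAC mul_sconj -smkM.
rewrite (smean_smk0 mmu) rnorm_smk0; apply: le_trans (ler_norm _).
have ch : continuous h.
  by move=> y; apply: cvgM; [exact: (continuous_sqr crker)|exact: cd].
have -> : N - r = imean mu (fun y => 1 * rnorm (ker x0 y) + - r).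
  by rewrite (mean_linear mmu)//; [rewrite mul1r (mean_cst mmu)|move=> y; exact: cvg_cst].
apply: (mean_le mmu) => //.
  move=> y; apply: cvgD; last exact: cvg_cst.
  by apply: cvgM; [exact: cvg_cst|exact: crker].
(* The integrand loses at most [r], because [(|k| - r) (|k| + r) = |k|^2 - r^2]. *)
move=> y; rewrite /h ler_pdivlMr// mul1r.
by have := sqr_ge0 r; have := rnorm_ge0 (ker x0 y); nra.
Qed.

End kernel.
End invariant.
End L2_inner_product.

(** * Projections onto S *)

Section ctsfun_complete.
Context {R : realType} {k : scalar_kind} {K : compactHausdorffType}.
Local Notation F := (scalar_field R k).
Local Notation C := (ctsfun R k K).

Lemma ball_ctsfunE (f : C) (e : R) : ball f (smk e 0 : F) = [set g | rnorm (f - g) < e].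
Proof.
rewrite -ball_normE; apply/seteqP; split=> g /=.
  by rewrite normr_rnorm ltr_smk.
by rewrite [in X in _ -> X]normr_rnorm ltr_smk.
Qed.

Lemma rnorm_le_sRe_sIm (z : F) : rnorm z <= `|sRe z| + `|sIm z|.
Proof.
rewrite -(@ler_pXn2r _ 2)// ?nnegrE ?rnorm_ge0 ?addr_ge0//.
rewrite rnorm_sqr sqrrD !real_normK ?num_real//.
by have := mulr_ge0 (normr_ge0 (sRe z)) (normr_ge0 (sIm z)); lra.
Qed.

(** A 1-Lipschitz functional sends a Cauchy filter to a convergent one. The conclusion is
    quantitative so that, applied to all point evaluations, it gives a bound uniform over the
    points. *)
Lemma cauchy_lipschitz_limit (FF : set_system C) (h : C -> R) : ProperFilter FF ->
  (forall e : R, 0 < e -> exists f : C, FF [set g | rnorm (f - g) < e]) ->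
  (forall f g, `|h f - h g| <= rnorm (f - g)) ->
  exists l, forall (f : C) (e : R), FF [set g | rnorm (f - g) < e] -> `|h f - l| <= e.
Proof.
move=> PF cF hl.
have : cvg (h @ FF).
  apply: cauchy_cvg; apply: cauchy_exP => e e0.
  have [f Ff] := cF _ e0; exists (h f).
  change (FF (h @^-1` ball (h f) e)); apply: filterS Ff => g fg; rewrite -ball_normE /=.
  exact: le_lt_trans (hl _ _) fg.
move=> /cvg_ex[l hFl]; exists l => f e Ff; apply/ler_addgt0Pr => r r0.
have /cvgrPdist_lt/(_ _ r0) Fl := hFl.
have [g [/= fg gl]] := filter_ex (filterI Ff Fl).
rewrite -(subrKA (h g)) (le_trans (ler_normD _ _))// lerD//.
  exact: le_trans (hl _ _) (ltW fg).
by rewrite distrC ltW.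
Qed.

Lemma ctsfun_cauchy_cvg (FF : set_system C) : ProperFilter FF -> cauchy FF -> cvg FF.
Proof.
move=> PF /cauchy_ballP cF.
have {}cF (e : R) : 0 < e -> exists f : C, FF [set g | rnorm (f - g) < e].
  move=> e0; have e0' : 0 < smk e 0 :> F by rewrite -smk00 ltr_smk.
  have [[U V] /= [FU FV] UV] := cF _ e0'.
  have [f Uf] := filter_ex FU; exists f; apply: filterS FV => g Vg.
  by have := UV (f, g) (conj Uf Vg); rewrite /= ball_ctsfunE.
have evB x (f g : C) : rnorm (f x - g x) <= rnorm (f - g) by exact: (rnorm_eval (f - g)).
have limRe x : exists l, forall (f : C) (e : R), FF [set g | rnorm (f - g) < e] -> `|sRe (f x) - l| <= e.
  apply: (@cauchy_lipschitz_limit _ (fun f => sRe (f x))) => // f g.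
  by rewrite -sReN -sReD; apply: le_trans (evB x f g); exact: sRe_norm.
have limIm x : exists l, forall (f : C) (e : R), FF [set g | rnorm (f - g) < e] -> `|sIm (f x) - l| <= e.
  apply: (@cauchy_lipschitz_limit _ (fun f => sIm (f x))) => // f g.
  by rewrite -sImN -sImD; apply: le_trans (evB x f g); exact: sIm_norm.
pose L x : F := smk (sval (cid (limRe x))) (sval (cid (limIm x))).
have FL (f : C) (e : R) x : FF [set g | rnorm (f - g) < e] -> rnorm (f x - L x) <= e + e.
  move=> Ff; apply: le_trans (rnorm_le_sRe_sIm _) _.
  rewrite sReD sReN sImD sImN /L sRe_smk sIm_smk -(sIm_unit (f x)) -mulrBr.
  case: cid => /= l /(_ _ _ Ff) fl; case: cid => /= l' /(_ _ _ Ff) fl'.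
  rewrite lerD// normrM; apply: le_trans fl'; rewrite ler_piMl//.
  by case: (k) => /=; rewrite ?normr0 ?normr1.
have cL : continuous L.
  move=> x; apply/(@cvg_rnormP _ _ F _ (nbhs x) (nbhs_filter x)) => e e0.
  (* The limit is within [2 e / 8] of [f] at each of the two points and [f] varies by less than
     [e / 8], in total less than [e]. *)
  have e8 : 0 < e / 8 by rewrite divr_gt0.
  have [f Ff] := cF _ e8.
  have /(@cvg_rnormP _ _ F _ (nbhs x) (nbhs_filter x))/(_ _ e8) fx :=
    @ctsfun_continuous _ _ _ f x.
  apply: filterS fx => y fxy.
  have Lfx := FL _ _ x Ff; have Lfy := FL _ _ y Ff.
  have -> : L x - L y = - (f x - L x) + ((f x - f y) + (f y - L y)).
    by rewrite subrKA opprB subrKA.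
  have := rnormD (- (f x - L x)) ((f x - f y) + (f y - L y)).
  have := rnormD (f x - f y) (f y - L y).
  rewrite rnormN; move: Lfx Lfy fxy; lra.
apply/cvg_ex; exists (CtsFun cL); apply/(@cvg_rnormP _ _ C _ FF _ id) => e e0.
have e4 : 0 < e / 4 by rewrite divr_gt0.
have [f Ff] := cF _ e4; apply: filterS (Ff) => g /= fg.
have Lf : rnorm (CtsFun cL - f : C) <= e / 4 + e / 4.
  by apply: rnorm_ctsfun_le => x; rewrite /= rnormB; exact: FL.
have := rnormD (CtsFun cL - f : C) (f - g); rewrite subrKA.
by move: Lf fg; lra.
Qed.

HB.instance Definition _ := Uniform_isComplete.Build C ctsfun_cauchy_cvg.

End ctsfun_complete.

Lemma linear_of (R : pzRingType) (V W : lmodType R) (f : V -> W) :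
  (forall a u v, f (a *: u + v) = a *: f u + f v) -> exists L : {linear V -> W}, L = f :> (V -> W).
Proof.
move=> flin; pose M := GRing.isLinear.Build R V W *:%R f flin.
pose L : {linear V -> W} := HB.pack f M.
by exists L.
Qed.

(** * Translations acting on [C(K)] *)

Section orbits.
Context {R : realType} {k : scalar_kind} {G : topologicalGroupType} {K : compactHausdorffType}.
Context (act : homogeneous_action G K).
Local Notation F := (scalar_field R k).
Local Notation C := (ctsfun R k K).

Lemma rnorm_translate g (f : C) : rnorm (translate act g f) <= rnorm f.
Proof. by apply: rnorm_ctsfun_le => x; exact: (rnorm_eval f). Qed.

Lemma translateM g h (f : C) : translate act g (translate act h f) = translate act (g * h)%g f.
Proof. by apply/ctsfunP => x; rewrite /= -actionM invgM. Qed.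

Lemma translate_linear g a (u v : C) :
  translate act g (a *: u + v) = a *: translate act g u + translate act g v.
Proof. by apply/ctsfunP. Qed.

(** Strong continuity of the translations, needed to average functions of [g] built from
    [translate act g f]. Joint continuity of the action gives the estimate near each [x], and
    compactness of [K] makes it uniform. *)
Lemma orbit_continuous (f : C) : continuous (fun g => translate act g f).
Proof.
move=> h; apply/(@cvg_rnormP _ _ C _ (nbhs h) (nbhs_filter h)) => e e0.
have e2 : 0 < e / 2 by rewrite divr_gt0.
have e4 : 0 < e / 2 / 2 by rewrite divr_gt0.
suff : \forall g \near h, [set: K] `<=`
    (fun x => rnorm (f (act h^-1%g x) - f (act g^-1%g x)) <= e / 2).
  apply: filterS => g H; apply: (@le_lt_trans _ _ (e / 2)).
    by apply: rnorm_ctsfun_le => x; exact: H.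
  by rewrite ltr_pdivrMr// ltr_pMr// ltr1n.
have /compact_near_coveringP cover := @compact_setT K.
apply: cover => x _.
have cc : continuous (fun p : K * G => f (act p.2^-1%g p.1)).
  move=> p; apply: (@continuous_comp _ _ _ (fun p : K * G => act p.2^-1%g p.1) f);
    last exact: ctsfun_continuous.
  apply: (@continuous_comp _ _ _ (fun p : K * G => (p.2^-1%g, p.1))
    (fun p : G * K => act p.1 p.2)); last exact: action_continuous.
  apply: cvg_pair; last exact: cvg_fst.
  by apply: continuous_comp; [exact: cvg_snd|exact: invg_continuous].
have /(@cvg_rnormP _ _ F)/(_ _ e4) H1 := cc (x, h).
have ch : continuous (fun p : K * G => f (act h^-1%g p.1)).
  move=> p; apply: (@continuous_comp _ _ _ fst (translate act h f)); first exact: cvg_fst.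
  exact: ctsfun_continuous.
have /(@cvg_rnormP _ _ F)/(_ _ e4) H2 := ch (x, h).
apply: filterS (filterI H1 H2) => -[x' g] /= [h1 h2].
have -> : f (act h^-1%g x') - f (act g^-1%g x') =
  - (f (act h^-1%g x) - f (act h^-1%g x')) + (f (act h^-1%g x) - f (act g^-1%g x')).
  by rewrite opprB subrKA.
apply: le_trans (rnormD _ _) _; rewrite rnormN.
by move: h1 h2; lra.
Qed.

End orbits.

(** * Averaging a projection into an equivariant one *)

Section averaged_projection.
Context {R : realType} {k : scalar_kind} {G : topologicalGroupType} {K : compactHausdorffType}.
Context (act : homogeneous_action G K) (mu : probability (borel K) R).
Local Notation F := (scalar_field R k).
Local Notation C := (ctsfun R k K).
Hypothesis compactG : compact [set: G].
Hypothesis mu_invariant : invariant_measure mu act.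

Lemma inner_continuous2 (T : topologicalType) (u v : T -> C) :
  continuous u -> continuous v -> continuous (fun t => inner_L2 mu (u t) (v t)).
Proof.
move=> cu cv t; apply/(@cvg_rnormP _ _ F _ (nbhs t) (nbhs_filter t)) => e e0.
have M0 : 0 < rnorm (u t) + rnorm (v t) + 1.
  by rewrite ltr_wpDl// addr_ge0// rnorm_ge0.
set M := rnorm (u t) + _ + 1 in M0.
(* The bound 1 keeps [rnorm (v s)] below [rnorm (v t) + 1]; with [e / M] the two terms of the
   bilinear splitting then add up to less than [e]. *)
have d0 : 0 < Num.min 1 (e / M) by rewrite lt_min ltr01 divr_gt0.
have /(@cvg_rnormP _ _ C _ (nbhs t) (nbhs_filter t))/(_ _ d0) Hu := cu t.
have /(@cvg_rnormP _ _ C _ (nbhs t) (nbhs_filter t))/(_ _ d0) Hv := cv t.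
apply: filterS (filterI Hu Hv) => s /= [us vs].
have -> : inner_L2 mu (u t) (v t) - inner_L2 mu (u s) (v s) =
    inner_L2 mu (u t - u s : C) (v s) + inner_L2 mu (u t) (v t - v s : C).
  by rewrite innerBl innerBr [RHS]addrC subrKA.
apply: le_lt_trans (rnormD _ _) _.
have r1 := rnorm_inner mu (u t - u s) (v s).
have r2 := rnorm_inner mu (u t) (v t - v s).
move: us vs; rewrite !lt_min => /andP[us1 us2] /andP[vs1 vs2].
have vs3 : rnorm (v s) <= rnorm (v t) + 1.
  have := rnormD (- (v t - v s)) (v t); rewrite opprB subrK -opprB rnormN.
  by move: vs1; lra.
apply: le_lt_trans (lerD r1 r2) _.
move: us2 vs2; rewrite !ltr_pdivlMr// => us2 vs2.
have := rnorm_ge0 (u t - u s); have := rnorm_ge0 (v t - v s).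
have := rnorm_ge0 (u t); have := rnorm_ge0 (v t); have := rnorm_ge0 (v s).
move: us2 vs2 vs3; rewrite /M.
set a := rnorm (u t - u s); set b := rnorm (v t - v s).
set p := rnorm (u t); set q := rnorm (v t); set q' := rnorm (v s).
move=> A B q'q q'0 q0 p0 b0 a0.
have H1 : a * q' <= a * (q + 1) by rewrite ler_wpM2l.
have [ab|ba] := leP a b.
  have : a * (q + 1) <= b * (q + 1) by rewrite ler_wpM2r// addr_ge0.
  by lra.
have : p * b <= p * a by rewrite ler_wpM2l// ltW.
by lra.
Qed.

(* [Q] is the mean over [g] of [L_g^-1 P L_g], taken coefficientwise in an
   orthonormal basis of [S] so that only scalar functions on [G] are averaged. *)
Lemma averaged_projection S (P : {linear C -> C}) :
  finite_dimensional S -> invariant_subspace act S -> is_projection S P ->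
  exists Q : {linear C -> C}, [/\ is_projection S Q, equivariant act Q &
    (opnorm Q <= opnorm P)%E].
Proof.
move=> Sfin Sinv [cP Pid PS].
have [c [opP c0 Pc]] := opnorm_bound cP.
have PSid v : S v -> P v = v by rewrite -PS => -[w _ <-].
have SP v : S (P v) by rewrite -PS; exists v.
have [n [e one]] := orthonormal_basis_exists mu_invariant Sfin.
have [_ Se] := one.
have expand v : S v -> v = \sum_j inner_L2 mu v (e j) *: e j.
  rewrite {1}Se => -[d ->]; apply: eq_bigr => j _.
  by rewrite (inner_basis _ _ one).
pose M (h : G -> F) := smean (@haar_mean R G) h.
have mM := haar_mean_is_mean compactG : is_mean (@haar_mean R G).
pose coef f j g := inner_L2 mu (P (translate act g f)) (translate act g (e j)).
have ccoef f j : continuous (coef f j).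
  apply: inner_continuous2; last exact: orbit_continuous.
  move=> g; apply: (@continuous_comp _ _ _ (fun g => translate act g f) P).
    exact: orbit_continuous.
  exact: cP.
pose Q f : C := \sum_j M (coef f j) *: e j.
have SQ f : S (Q f) by exact: spans_sum.
(* [L_g^-1 P L_g f] is expanded in the basis; moving [L_g] across the invariant inner product turns
   its coefficients into [coef f j g]. *)
have coefE f x g : \sum_j coef f j g * e j x = P (translate act g f) (act g x).
  have : S (translate act g^-1%g (P (translate act g f))) by exact: Sinv.
  set w := translate _ _ _ => /expand wE.
  have -> : P (translate act g f) (act g x) = w x by rewrite /= invgK.
  rewrite wE ctsfun_sumE; apply: eq_bigr => j _; congr (_ * _).
  rewrite -(inner_translate mu_invariant g) translateM mulgV.
  congr (inner_L2 mu _ _); apply/funext => y /=.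
  by rewrite invg1 action1.
have cPx f x : continuous (fun g => P (translate act g f) (act g x)).
  under eq_fun do rewrite -coefE.
  apply: (@continuous_sum F F) => j g.
  by apply: cvgM; [exact: ccoef|exact: cvg_cst].
(* A pointwise formula without the basis, from which linearity, the identity on [S], the norm bound
   and equivariance are read off. *)
have QE f x : Q f x = M (fun g => P (translate act g f) (act g x)).
  rewrite /Q ctsfun_sumE; under [in RHS]eq_fun do rewrite -coefE.
  rewrite /M (smean_sum mM) => [|j g]; last first.
    by apply: cvgM; [exact: ccoef|exact: cvg_cst].
  apply: eq_bigr => j _; rewrite /= mulrC -(smeanZ mM (e j x) (@ccoef f j)).
  by congr smean; apply/funext => g; rewrite mulrC.
have Qlin a u v : Q (a *: u + v) = a *: Q u + Q v.
  apply/ctsfunP => x; rewrite /= !QE /M -(smean_linear mM); [|exact: cPx..].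
  by congr smean; apply/funext => g; rewrite translate_linear linearP.
have QSid v : S v -> Q v = v.
  move=> Sv; apply/ctsfunP => x; rewrite QE -[RHS](smean_cst mM); congr smean.
  by apply/funext => g; rewrite PSid; [rewrite /= actK|exact: Sinv].
have Qc f : rnorm (Q f) <= c * rnorm f.
  apply: rnorm_ctsfun_le => x; rewrite QE; apply: (rnorm_smean_le mM) => [|g].
    exact: cPx.
  apply: le_trans (rnorm_eval _ _) _; apply: le_trans (Pc _) _.
  by rewrite ler_wpM2l// rnorm_translate.
have [L LQ] := linear_of Qlin.
have Lc f : rnorm (L f) <= c * rnorm f by rewrite LQ.
have cL : continuous L.
  exact: rnorm_bounded_continuous Lc.
exists L; split.
- split; [exact: cL|by move=> y; rewrite !LQ QSid|].
  rewrite LQ; apply/seteqP; split=> [_ [y _ <-]//|y Sy].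
  by exists y => //; exact: QSid.
(* Equivariance is the substitution of [g * a] for [g], since [P (L_g L_a f) (g x)] is [P (L_ga f)]
   at [g a (a^-1 x)]; right invariance of the mean permits it. *)
- move=> a f; rewrite !LQ; apply/ctsfunP => x; rewrite /= !QE.
  have cf := cPx f (act a^-1%g x).
  rewrite /M /smean -(haar_mean_translate compactG a (continuous_sRe cf)).
  rewrite -(haar_mean_translate compactG a (continuous_sIm cf)).
  by congr smk; congr haar_mean; apply/funext => g; rewrite translateM actionM actKV.
- by rewrite opP; exact: opnorm_le.
Qed.

End averaged_projection.

(** * Projections in an arbitrary ambient space *)

Section upper_bound.
Context {R : realType} {k : scalar_kind} {G : topologicalGroupType} {K : compactHausdorffType}.
Context (act : homogeneous_action G K) (mu : probability (borel K) R).
Local Notation F := (scalar_field R k).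
Local Notation C := (ctsfun R k K).
Hypothesis mu_invariant : invariant_measure mu act.

(** Since [i] is linear on [X] only, membership of the partial sums in [X] is carried through the
    induction. *)
Lemma isometric_embedding_sum {V W : normedModType F} (X : set V) (i : V -> W)
    n (c : 'I_n -> F) (v : 'I_n -> V) :
  isometric_embedding X i -> X 0 -> (forall a x y, X x -> X y -> X (a *: x + y)) ->
  (forall j, X (v j)) ->
  X (\sum_j c j *: v j) /\ i (\sum_j c j *: v j) = \sum_j c j *: i (v j).
Proof.
move=> [ilin iiso] X0 Xlin Xv; apply: (big_ind2 (fun x y => X x /\ i x = y)) => [|x _ y _ [Xx <-] [Xy <-]|j _].
- by split=> //; apply/eqP; rewrite -normr_eq0 iiso// normr0.
- by split; [rewrite -[x]scale1r; exact: Xlin|have := ilin 1 x y Xx Xy; rewrite !scale1r].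
- have i0 : i 0 = 0 by apply/eqP; rewrite -normr_eq0 iiso// normr0.
  split; first by rewrite -[_ *: _]addr0; exact: Xlin.
  by rewrite -[X in i X]addr0 ilin// i0 addr0.
Qed.

(* Hahn-Banach is applied once, to the functional [v |-> sum_j <i^-1 v_j, e_j>] on
   [i(S)^n], a subspace of [Y^n] with the seminorm
   [p v = \int |sum_j conj (e_j x) v_j| dmu x].  Restricting the extension to the
   [n] coordinates of [Y^n] yields the coefficients of a projection [Y -> i(S)];
   evaluating it at [(e_j x y)_j], where [p] is [|y| \int |k(x, z)| dmu z], bounds
   the norm of that projection. *)
Lemma rel_projconst_le S n (e : 'I_n -> C) x0 (Y : normedModType F) (i : C -> Y) :
  orthonormal_basis mu S e -> invariant_subspace act S -> isometric_embedding S i ->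
  (rel_projconst (i @` S) <= (imean mu (fun y => rnorm (basis_kernel e x0 y)))%:E)%E.
Proof.
move=> one Sinv isoi; have [ilin iiso] := isoi; have [_ Se] := one.
have mmu := imean_is_mean mu.
have S0 := spans0 Se; have Slin a u v := @spans_lin _ _ _ _ _ _ a u v Se.
have eS j : S (e j) := spans_mem j Se.
have rnormi s : S s -> rnorm (i s) = rnorm s by move=> Ss; rewrite /rnorm iiso.
have iD a s t : S s -> S t -> i (a *: s + t) = a *: i s + i t by exact: ilin.
have i0 : i 0 = 0 by apply: rnorm0_eq0; rewrite rnormi// rnorm0.
have iinj s t : S s -> S t -> i s = i t -> s = t.
  move=> Ss St st; have Sd : S (-1 *: t + s) by exact: Slin.
  have : i (-1 *: t + s) = 0 by rewrite iD// st scaleN1r addNr.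
  move=> /(congr1 rnorm); rewrite rnorm0 rnormi// => /rnorm0_eq0.
  by rewrite scaleN1r addrC => /eqP; rewrite subr_eq0 => /eqP.
have isum m (c : 'I_m -> F) s := @isometric_embedding_sum _ _ _ i m c s isoi S0 Slin.
(* The inverse of [i] on [i(S)], with value 0 elsewhere. *)
pose iinv y : C := xget 0 [set s | S s /\ i s = y].
have iinvP y : (i @` S) y -> S (iinv y) /\ i (iinv y) = y.
  by move=> [s Ss sy]; apply: (@xgetPex _ 0 [set s | S s /\ i s = y]); exists s.
have iinvK s : S s -> iinv (i s) = s.
  by move=> Ss; have [|? ?] := @iinvP (i s); [exists s|exact: iinj].
have iinvlin a y z : (i @` S) y -> (i @` S) z -> iinv (a *: y + z) = a *: iinv y + iinv z.
  move=> [s Ss <-] [t St <-]; rewrite -iD// !iinvK//; exact: Slin.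
pose V := {ffun 'I_n -> Y}.
pose u (v : V) x := \sum_j sconj (e j x) *: v j.
have cu v : continuous (u v).
  apply: (@continuous_sum F Y K 'I_n _ (fun j x => sconj (e j x) *: v j)) => j x.
  apply: (@cvgZ _ Y K (nbhs x)); last exact: cvg_cst.
  exact: (continuous_sconj (@ctsfun_continuous _ _ _ (e j))).
have cru v := continuous_rnorm (cu v).
pose p (v : V) := imean mu (fun x => rnorm (u v x)).
pose W : set V := [set v | forall j, (i @` S) (v j)].
pose f (v : V) := \sum_j inner_L2 mu (iinv (v j)) (e j).
have [L [Llin Lf Lp]] : exists L : V -> F,
    [/\ forall a v w, L (a *: v + w) = a * L v + L w,
        forall v, W v -> L v = f v & forall v, rnorm (L v) <= p v].
  apply: hahn_banach_scalar.
  - move=> v w; rewrite /p -[leRHS](_ : imean mu (fun x => 1 * rnorm (u v x) + rnorm (u w x)) = _).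
      apply: (mean_le mmu) => [|x|x]; first exact: cru.
        apply: cvgD; last exact: cru.
        by apply: cvgM; [exact: cvg_cst|exact: cru].
      rewrite mul1r; apply: le_trans (rnormD _ _); rewrite /u -big_split /=.
      by under eq_bigr do rewrite ffunE scalerDr.
    by rewrite (mean_linear mmu) ?mul1r//; exact: cru.
  - move=> a v; rewrite /p -(meanZ mmu); last exact: cru.
    congr imean; apply/funext => x; rewrite -rnormZ /u scaler_sumr; congr rnorm.
    by apply: eq_bigr => j _; rewrite ffunE !scalerA mulrC.
  - by move=> j; rewrite ffunE; exists 0.
  - move=> a v w Wv Ww j; rewrite !ffunE.
    have [s Ss <-] := Wv j; have [t St <-] := Ww j.
    by exists (a *: s + t); [exact: Slin|exact: iD].
  - move=> a v w Wv Ww; rewrite /f mulr_sumr -big_split; apply: eq_bigr => j _ /=.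
    by rewrite !ffunE iinvlin// inner_linear.
  - move=> v Wv.
    have cj (j : 'I_n) := @inner_continuous R k K (iinv (v j)) (e j).
    have -> : f v = smean (imean mu) (fun x => \sum_j iinv (v j) x * sconj (e j x)).
      by rewrite (smean_sum mmu).
    have cs : continuous (fun x => \sum_j iinv (v j) x * sconj (e j x)).
      exact: (@continuous_sum F F).
    apply: le_trans (rnorm_smean mmu cs) _; apply: (mean_le mmu) => [||x].
    + exact: continuous_rnorm.
    + exact: cru.
    have Sv (j : 'I_n) : S (iinv (v j)) := (iinvP _ (Wv j)).1.
    (* The integrand at [x] is the value at [x] of an element of [S] whose image under [i] is
       [u v x]; it is bounded by the supremum norm of that element, which [i] preserves. *)
    have [Ssum isumE] := isum n (fun j => sconj (e j x)) _ Sv.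
    have -> : u v x = i (\sum_j sconj (e j x) *: iinv (v j)).
      by rewrite isumE; apply: eq_bigr => j _; rewrite (iinvP _ (Wv j)).2.
    rewrite rnormi//; apply: le_trans (rnorm_eval _ x).
    by rewrite ctsfun_sumE; under eq_bigr do rewrite mulrC.
have L0 : L 0 = 0.
  have := Llin (-1) 0 0; rewrite scaler0 addr0 mulN1r addNr; exact.
pose d (j : 'I_n) (y : Y) : V := [ffun l => if l == j then y else 0].
have dlin j a y z : d j (a *: y + z) = a *: d j y + d j z.
  by apply/ffunP => l; rewrite !ffunE; case: eqP => // _; rewrite scaler0 addr0.
have Lsum m (c : 'I_m -> F) (v : 'I_m -> V) : L (\sum_j c j *: v j) = \sum_j c j * L (v j).
  apply: (big_ind2 (fun v w => L v = w)) => // [v1 _ v2 _ <- <-|j _].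
    by have := Llin 1 v1 v2; rewrite scale1r mul1r.
  by rewrite -[X in L X]addr0 Llin L0 addr0.
pose P y : Y := \sum_j L (d j y) *: i (e j).
have PE y : S (\sum_j L (d j y) *: e j) /\ P y = i (\sum_j L (d j y) *: e j).
  by have [Ssum ->] := isum n (fun j => L (d j y)) e eS.
have Plin a y z : P (a *: y + z) = a *: P y + P z.
  rewrite /P scaler_sumr -big_split; apply: eq_bigr => j _.
  by rewrite dlin Llin scalerDl scalerA.
(* The entries of [d j (i s)] lie in [i(S)], where [L] agrees with [f] and returns the coefficient
   of [s] along [e j]. *)
have Pid s : S s -> P (i s) = i s.
  move=> Ss; rewrite (PE _).2; congr i; move: (Ss); rewrite {1}Se => -[c cE].
  rewrite {2}cE; apply: eq_bigr => j _; congr (_ *: _); rewrite Lf; last first.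
    by move=> l; rewrite ffunE; case: eqP => _; [exists s|exists 0].
  rewrite /f (bigD1 j)//= ffunE eqxx iinvK// cE (inner_basis _ _ one).
  rewrite big1 ?addr0// => l lj; rewrite ffunE (negbTE lj).
  by rewrite -[X in iinv X]i0 iinvK// inner0l.
set N := imean mu _.
have N0 : 0 <= N.
  apply: (mean_ge0 mmu) => [|y]; last exact: rnorm_ge0.
  exact: (continuous_rnorm (@kernel_continuous _ _ _ _ e x0)).
have Pbound y : rnorm (P y) <= N * rnorm y.
  have [Ssum ->] := PE y; rewrite rnormi//; apply: rnorm_ctsfun_le => x.
  rewrite ctsfun_sumE.
  have -> : \sum_j (L (d j y) *: e j : C) x = L (\sum_j e j x *: d j y).
    by rewrite Lsum; apply: eq_bigr => j _; rewrite mulrC.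
  apply: le_trans (Lp _) _; rewrite /N (kernel_norm_indep mu_invariant one Sinv x0 x).
  rewrite mulrC -(meanZ mmu); last exact: (continuous_rnorm (@kernel_continuous _ _ _ _ e x)).
  rewrite /p; apply: (mean_le mmu) => [|z|z]; first exact: cru.
    by apply: cvgM; [exact: cvg_cst|exact: (continuous_rnorm (@kernel_continuous _ _ _ _ e x))].
  (* At [z], [u] of the vector with entries [e j x *: y] is [conj k(x, z) *: y], so equality holds
     pointwise. *)
  rewrite -rnorm_conj mulrC -rnormZ /u le_eqVlt; apply/orP; left; apply/eqP.
  congr rnorm; rewrite /basis_kernel sconj_sum scaler_suml; apply: eq_bigr => j _.
  rewrite sconjM sconjK sum_ffunE (bigD1 j)//= !ffunE eqxx big1 => [|l lj].
    by rewrite addr0 scalerA mulrC.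
  by rewrite !ffunE eq_sym (negbTE lj) scaler0.
have [Q QP] := linear_of Plin.
have Qbound y : rnorm (Q y) <= N * rnorm y by rewrite QP.
apply: (@le_trans _ _ (opnorm Q)); last exact: opnorm_le.
apply: ereal_inf_lbound; exists Q => //; rewrite /is_projection QP.
split; first by rewrite -QP; exact: rnorm_bounded_continuous Qbound.
- by move=> y; rewrite (PE y).2 Pid//; exact: (PE y).1.
- apply/seteqP; split=> [_ [y _ <-]|_ [s Ss <-]]; last by exists (i s) => //; exact: Pid.
  by have [Ssum ->] := PE y; exists (\sum_j L (d j y) *: e j).
Qed.

End upper_bound.

Theorem theorem1p2 (R : realType) (k : scalar_kind)
    (G : topologicalGroupType) (K : compactHausdorffType)
    (act : homogeneous_action G K) (mu : probability (borel K) R)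
    (S : set (ctsfun R k K))
    (compactG : compact [set: G])
    (mu_regular : regular_measure mu)
    (mu_invariant : invariant_measure mu act)
    (S_accessible : accessible act mu S)
    (x0 : K) :
  projconst S = opnorm (fun f : ctsfun R k K => orth_proj mu S f) /\
  opnorm (fun f : ctsfun R k K => orth_proj mu S f)
  = (\int[mu]_y (rnorm (rep_kernel mu S x0 y))%:E)%E.
Proof.
have [Sfin Sinv Sacc] := S_accessible.
have [n [e one]] := orthonormal_basis_exists mu_invariant Sfin.
have opE := opnorm_orth_proj mu_invariant one Sinv x0.
split; last first.
  rewrite opE (rep_kernelE one) EFin_imean//.
  exact: (continuous_rnorm (@kernel_continuous _ _ _ _ e x0)).
apply/eqP; rewrite eq_le; apply/andP; split.
  apply: ge_ereal_sup => _ [Y [i [isoi ->]]]; rewrite opE.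
  exact: (rel_projconst_le mu_invariant).
(* The inclusion of [S] in the complete space [C(K)] is one of the embeddings in the supremum. *)
apply: (@le_trans _ _ (rel_projconst (id @` S))); last first.
  by apply: ereal_sup_ubound; exists (ctsfun R k K), id; split=> //; split.
rewrite image_id; apply: le_ereal_inf_tmp => _ [P Pproj ->].
have [Q [Qproj Qeq QP]] := averaged_projection compactG mu_invariant Sfin Sinv Pproj.
apply: le_trans QP; apply: ge_ereal_sup => _ [f f1 <-]; rewrite -(Sacc Q Qproj Qeq).
by apply: ereal_sup_ubound; exists f.
Qed.
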